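(* Let $\lambda$ be a self-adjoint operator on $\overline V$ whose characteristic polynomial $p_\lambda$ has distinct roots in $\bar k$ (equivalently, a stable functional). Then the element $[\lambda-\lambda_{KW}]$ of $C_\lambda^\vee$ measuring the position of $\lambda$ relative to the Kostant–Weierstrass section is the character defined by $$c_i\mapsto(-1)^{d_i-1}\left(\frac{(-1)^{\lfloor d_i/2\rfloor}}{q}\right)\left(\frac{\eta_i}{q^{d_i}}\right)\prod_{j\ne i}\ \prod_{t=1}^{\gcd(d_i,d_j)}\left(\frac{\delta_i-\delta_j^{q^{t-1}}}{q^{[d_i,d_j]}}\right).$$
   Context: $k$ is a finite field of size $q$ and characteristic $>2$, $k_d$ its extension of degree $d$, $\left(\frac{\cdot}{q^d}\right)$ the quadratic character of $k_d^\times$, $[a,b]$ the least common multiple. $\overline V=k^n$ carries the form $\langle x,y\rangle=x_1y_n+x_2y_{n-1}+\dots+x_ny_1$, with orthogonal group $\mathrm O_n$ acting by conjugation on self-adjoint operators. (In the paper $k=k_F$, and the self-adjoint matrices form the representation $\mathsf V_x$ of $\mathrm O_n$; via the trace form stable functionals on $\mathsf V_x$, i.e. those with finite stabilizer and closed orbit, are the same as self-adjoint matrices with separable characteristic polynomial.) Write $p_\lambda=\prod_{i=1}^mp_i$ with $p_i\in k[T]$ irreducible of degree $d_i$, $k_i=k[T]/p_i(T)\cong k_{d_i}$, and let $\delta_i\in k_{d_i}$ be any root of $p_i$. Then $\overline V=\bigoplus_i\ker p_i(\lambda)$ orthogonally, with $\ker p_i(\lambda)\cong k_i$ as $k[T]$-modules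 ($T$ acting by $\lambda$), and one may write $\langle x,y\rangle=\sum_i\mathrm{Tr}_{k_i/k}(\eta_ix_iy_i)$ with $\eta_i\in k_i^\times$ (well defined modulo squares). The stabilizer of $\lambda$ in $\mathrm O_n$ is $D_\lambda=\mathrm{Res}_{(k[T]/p_\lambda)/k}\,\mu_2$; $C_\lambda=D_\lambda(k)=\prod_i\mu_2(k_i)$, and $c_i\in C_\lambda$ is $-1$ in the $i$-th factor and $1$ elsewhere. $C_\lambda^\vee$ is the character group of $C_\lambda$. *Kostant–Weierstrass section.* $\lambda_{KW}$ is the unique matrix with characteristic polynomial $p_\lambda$ having first row $(a_1,\dots,a_n)$, last column $(a_n,a_{n-1},\dots,a_1)^T$ (top to bottom), ones on the subdiagonal, and zeros elsewhere; it is self-adjoint, and it is conjugate to $\lambda$ under $\mathrm{SO}_n(\bar k)$. Choose $g\in\mathrm{SO}_n(\bar k)$ with $\lambda=g\lambda_{KW}g^{-1}$; the cocycle $\sigma\mapsto g^{-1}\sigma(g)$ defines a class in $H^1(k,D_\lambda)=\prod_ik_i^\times/k_i^{\times2}$ (the stabilizers of $\lambda$ and $\lambda_{KW}$ being canonically identified). Tate duality over the finite field gives $H^1(k,D_\lambda)\cong H^0(k,D_\lambda)^\vee=C_\lambda^\vee$, under which $(a_i)_i$ corresponds to the character $c_i\mapsto\left(\frac{a_i}{q^{d_i}}\right)$. The resulting element of $C_\lambda^\vee$ is $[\lambda-\lambda_{KW}]$. *)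

(* Defs.v *)
From HB Require Import structures.
From mathcomp Require Import all_boot all_order all_algebra all_fingroup.
From mathcomp Require Import all_solvable all_field all_character.
From mathcomp Require Import boolp.

Set Implicit Arguments.
Unset Strict Implicit.
Unset Printing Implicit Defensive.

Import GRing.Theory.
Local Open Scope ring_scope.

Section OrthogonalSpace.

Variables (R : comUnitRingType) (n : nat).

Definition antidiag_form (x y : 'cV[R]_n) : R :=
  \sum_i x i 0 * y (rev_ord i) 0.

Definition self_adjoint (A : 'M[R]_n) : Prop :=
  forall x y, antidiag_form (A *m x) y = antidiag_form x (A *m y).

Definition special_orthogonal (g : 'M[R]_n) : Prop :=
  (forall x y, antidiag_form (g *m x) (g *m y) = antidiag_form x y)
  /\ \det g = 1.

(* With 0-based indices the last column (a_n, ..., a_1)^T has entry           *)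
(* a (rev_ord i) in row i.                                                    *)
Definition KW_matrix (a : 'I_n -> R) : 'M[R]_n :=
  \matrix_(i, j)
    if val i == 0%N then a j
    else if j.+1 == n then a (rev_ord i)
    else (val i == j.+1)%:R.

End OrthogonalSpace.

(* The quadratic character of the subfield S of R, extended by 0 at 0.        *)
Definition quad_char (R : nzRingType) (S : {pred R}) (x : R) : int :=
  if x == 0 then 0
  else if `[< exists2 y, y \in S & y ^+ 2 = x >] then 1 else -1.

(* The degree d extension of F inside an algebraic closure K.                 *)
Definition degree_subfield (F : finFieldType) (K : fieldType) (d : nat)
  : {pred K} := [pred x : K | x ^+ (#|F| ^ d) == x].

(* The trace of multiplication by x on F[T]/(p), in the basis 1, T, T^2, ...  *)
Definition qpoly_trace (F : fieldType) (p : {poly F}) (x : {poly %/ p}) : F :=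
  \tr (\matrix_(i, j < (size p).-1)
         ((in_qpoly p 'X^j * x : {poly %/ p}) : {poly F})`_i).

(* phi i identifies k_i = F[T]/(p i) with the kernel of (p i)(lam), and the   *)
(* form becomes the sum of the Tr(eta_i x_i y_i).                             *)
Definition form_decomposition (F : finFieldType) (n : nat) (lam : 'M[F]_n.+1)
    (m : nat) (p : 'I_m -> {poly F}) (eta : forall i, {unit {poly %/ p i}})
    (phi : forall i, {poly %/ p i} -> 'cV[F]_n.+1) : Prop :=
  [/\ forall i, linear (phi i) /\ injective (phi i),
      forall i x, phi i ('qX * x) = lam *m phi i x,
      forall i v, horner_mx lam (p i) *m v = 0 <-> exists x, phi i x = v &
      forall x y : forall i, {poly %/ p i},
        antidiag_form (\sum_i phi i (x i)) (\sum_i phi i (y i))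
        = \sum_i qpoly_trace (val (eta i) * x i * y i)].

Section ComponentGroup.

Definition mu2 (A : finComUnitRingType) : {set {unit A}} :=
  [set u | u ^+ 2 == 1]%g.

Lemma mu2_group_set (A : finComUnitRingType) : group_set (mu2 A).
Proof.
apply/group_setP; split=> [|u v]; first by rewrite inE expg1n.
rewrite !inE => /eqP u2 /eqP v2.
rewrite expgMn ?u2 ?v2 ?mulg1 //.
by apply: val_inj; rewrite /= mulrC.
Qed.

Canonical mu2_group (A : finComUnitRingType) := Group (mu2_group_set A).

Variables (F : finFieldType) (m : nat) (p : 'I_m -> {poly F}).

(* C_lambda = D_lambda(k) = \prod_i mu_2(k_i). *)
Definition comp_group : {group {dffun forall i, {unit {poly %/ p i}}}} :=
  [group of setXn (fun i => mu2 {poly %/ p i})].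

Definition comp_gen (i : 'I_m) : {dffun forall j, {unit {poly %/ p j}}} :=
  dfung1 (FinRing.unit {poly %/ p i} (unitrN1 _)).

End ComponentGroup.

Section RelativePosition.

Variables (F : finFieldType) (K : closedFieldType) (iota : {rmorphism F -> K}).

Local Notation "p ^io" := (map_poly iota p) (at level 2, format "p ^io").

Definition galois_aut (s : {rmorphism K -> K}) : Prop :=
  bijective s /\ forall x, s (iota x) = iota x.

(* For p over F, {poly %/ p^io} is (F[T]/(p)) \otimes K; its 2-torsion units  *)
(* are the K-points of the restriction of scalars of mu_2 from F[T]/(p) to F. *)
Definition galois_act (p : {poly F}) (s : {rmorphism K -> K})
    (r : {poly %/ p^io}) : {poly %/ p^io} :=
  in_qpoly p^io (map_poly s r).

Definition cohomologous (p : {poly F})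
    (c c' : {rmorphism K -> K} -> {poly %/ p^io}) : Prop :=
  exists2 e : {poly %/ p^io}, e ^+ 2 = 1 &
    forall s, galois_aut s -> c' s = c s * (e^-1 * galois_act s e).

(* The class of c in H^1(F, Res mu_2) is the Kummer class of alpha.           *)
Definition kummer_class (p : {poly F})
    (c : {rmorphism K -> K} -> {poly %/ p^io}) (alpha : {unit {poly %/ p}})
    : Prop :=
  exists2 b : {poly %/ p^io},
    b ^+ 2 = in_qpoly p^io (val alpha : {poly F})^io &
    cohomologous c (fun s => b^-1 * galois_act s b).

(* The cocycle s |-> g^-1 s(g), with values in the stabilizer of M, which is  *)
(* identified with the 2-torsion units r of K[T]/(q) by r |-> r(M), where q is  *)
(* the characteristic polynomial of M.                                        *)
Definition is_cocycle_of (n : nat) (q : {poly F}) (M : 'M[F]_n.+1)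
    (g : 'M[K]_n.+1) (c : {rmorphism K -> K} -> {poly %/ q^io}) : Prop :=
  forall s, galois_aut s ->
    c s ^+ 2 = 1 /\
    horner_mx (map_mx iota M) (c s : {poly K}) = invmx g *m map_mx s g.

(* chi is the element [lam - lam_KW] of the dual of C_lambda, for some choice *)
(* of g; the class of the cocycle is taken componentwise along                *)
(* D_lambda = \prod_i Res_{k_i/k} mu_2.                                       *)
Definition relative_position (n : nat) (lam : 'M[F]_n.+1)
    (m : nat) (p : 'I_m -> {poly F}) (chi : 'CF(comp_group p)) : Prop :=
  exists (a : 'I_n.+1 -> F) (g : 'M[K]_n.+1)
         (c : {rmorphism K -> K} -> {poly %/ (char_poly lam)^io})
         (alpha : forall i, {unit {poly %/ p i}}),
  [/\ char_poly (KW_matrix a) = char_poly lam,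
      special_orthogonal g
      /\ map_mx iota lam = g *m map_mx iota (KW_matrix a) *m invmx g,
      is_cocycle_of (KW_matrix a) g c,
      forall i, kummer_class (fun s => in_qpoly (p i)^io (c s : {poly K}))
                             (alpha i) &
      chi \is a linear_char
      /\ forall i, chi (comp_gen p i) = (quad_char predT (val (alpha i)))%:~R].

End RelativePosition.

(* Main.v *)
Require Import Defs.
From HB Require Import structures.
From mathcomp Require Import all_boot all_order all_algebra all_fingroup.
From mathcomp Require Import all_solvable all_field all_character.
From mathcomp Require Import zify ring.
From mathcomp Require boolp.

Set Implicit Arguments.
Unset Strict Implicit.
Unset Printing Implicit Defensive.

Import GRing.Theory.
Local Open Scope ring_scope.

(**
Let v = g e_1, where g carries the Kostant-Weierstrass matrix M to lam. Since
e_1, M e_1, ..., M^(N-1) e_1 is unitriangular and the form pairs the first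
coordinate with the last one, <v, f(lam) v> is the coefficient of T^(N-1) in f
for deg f < N. Taking f = p_lam / (T - w) for a root w of p_i, and comparing
with the eigenvector u_w = (p_i / (T - w))(lam) phi_i(1), one gets
<u_w, v>^2 p_lam'(w) = <u_w, u_w> = eta_i(w) p_i'(w)^2, the last step by the trace
formula. The function w |-> <u_w, v> is equivariant up to the cocycle of g, so
the i-th component of the class is the Kummer class of
eta_i p_i' / \prod_(j != i) p_j.

The quadratic characters are then computed with Euler's criterion:
p_i'(delta_i)^((q^d - 1)/2) by pairing delta - delta^(q^t) with
delta - delta^(q^(d-t)), and p_j(delta_i) by grouping its linear factors into
norms from the compositum of k_i and k_j.
*)

(** * Evaluation of classes modulo a polynomial *)

(** The relative position is defined through choices: the section matrix, [g], the cocycle and the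
    Kummer representatives. So, besides the formula, it must be shown that some choice exists and
    that all choices give the same character. Uniqueness needs only one automorphism: if b^2 =
    alpha, then alpha^((q^d - 1)/2) = b^(q^d - 1) is a product of values of the cocycle at
    Frobenius, so Frobenius alone determines the character. Existence needs a section matrix over F
    with the prescribed characteristic polynomial, and then a conjugating isometry over K of
    determinant exactly 1. Elements of k_i and of its extension to K are handled by their values at
    the roots of p_i, which turns identities of algebras into identities in K. Quadratic characters
    are integers while Euler's criterion is an identity in K; as 1 and -1 differ in K, comparing
    signs there is enough. The first two signs of the formula come from p_i'(delta_i), the double
    product from the p_j(delta_i). *)

Lemma in_qpoly_mod (R : comNzRingType) (p : {poly R}) (p_mon : p \is monic)
    (p_gt1 : (1 < size p)%N) (f : {poly R}) :
  exists u, (in_qpoly p f : {poly R}) = f - u * p.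
Proof.
(* Reduction is modulo [mk_monic p], which falls back to ['X] unless [p] is monic of positive
   degree. *)
have pE : mk_monic p = p by rewrite /mk_monic p_gt1 p_mon.
rewrite /= pE; exists (Pdiv.CommonRing.rdivp f p).
by rewrite {2}(Pdiv.RingMonic.rdivp_eq p_mon f) addrC addKr.
Qed.

Lemma qpoly_mul_mod (R : comNzRingType) (p : {poly R}) (p_mon : p \is monic)
    (p_gt1 : (1 < size p)%N) (x y : {poly %/ p}) :
  exists u, ((x * y : {poly %/ p}) : {poly R}) = (x : {poly R}) * y - u * p.
Proof. exact: in_qpoly_mod. Qed.

Lemma size_qpoly (R : comNzRingType) (p : {poly R}) (p_mon : p \is monic)
    (p_gt1 : (1 < size p)%N) (x : {poly %/ p}) : (size (x : {poly R}) < size p)%N.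
Proof.
have pE : mk_monic p = p by rewrite /mk_monic p_gt1 p_mon.
by apply: leq_trans (size_mk_monic x) _; rewrite pE.
Qed.

Section EvalAtRoot.

Variables (R S : comNzRingType) (f : {rmorphism R -> S}) (p : {poly R}).
Hypotheses (p_mon : p \is monic) (p_gt1 : (1 < size p)%N).
Variable z : S.
Hypothesis pz0 : root (map_poly f p) z.

Definition qpoly_eval (x : {poly %/ p}) : S := (map_poly f x).[z].

Lemma qpoly_evalD : {morph qpoly_eval : x y / x + y}.
Proof. by move=> x y; rewrite /qpoly_eval poly_of_qpolyD rmorphD hornerD. Qed.

Lemma qpoly_evalM : {morph qpoly_eval : x y / x * y}.
Proof.
move=> x y; rewrite /qpoly_eval; have [u ->] := qpoly_mul_mod p_mon p_gt1 x y.
by rewrite rmorphB !rmorphM hornerD hornerN !hornerM (rootP pz0) mulr0 subr0.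
Qed.

Lemma qpoly_eval1 : qpoly_eval 1 = 1.
Proof. by rewrite /qpoly_eval qpolyCE rmorph1 hornerC. Qed.

Lemma qpoly_eval0 : qpoly_eval 0 = 0.
Proof. by rewrite /qpoly_eval rmorph0 horner0. Qed.

Lemma qpoly_evalX k : {morph qpoly_eval : x / x ^+ k}.
Proof.
move=> x; elim: k => [|k IHk]; first by rewrite !expr0 qpoly_eval1.
by rewrite !exprS qpoly_evalM IHk.
Qed.

Lemma qpoly_eval_in g : qpoly_eval (in_qpoly p g) = (map_poly f g).[z].
Proof.
rewrite /qpoly_eval; have [u ->] := in_qpoly_mod p_mon p_gt1 g.
by rewrite rmorphB rmorphM hornerD hornerN hornerM (rootP pz0) mulr0 subr0.
Qed.

End EvalAtRoot.

Lemma root_map_id (R : nzRingType) (p : {poly R}) z :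
  root p z -> root (map_poly idfun p) z.
Proof. by rewrite map_poly_id. Qed.

Section HornerAtRoot.

Variables (R : comNzRingType) (p : {poly R}).
Hypotheses (p_mon : p \is monic) (p_gt1 : (1 < size p)%N).
Variable z : R.
Hypothesis pz0 : root p z.

Lemma qpoly_eval_id (x : {poly %/ p}) : qpoly_eval idfun z x = (x : {poly R}).[z].
Proof. by rewrite /qpoly_eval map_poly_id. Qed.

Lemma horner_qpolyM (x y : {poly %/ p}) :
  ((x * y : {poly %/ p}) : {poly R}).[z] = (x : {poly R}).[z] * (y : {poly R}).[z].
Proof. by rewrite -!qpoly_eval_id qpoly_evalM // root_map_id. Qed.

Lemma horner_qpolyX (x : {poly %/ p}) k :
  ((x ^+ k : {poly %/ p}) : {poly R}).[z] = (x : {poly R}).[z] ^+ k.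
Proof. by rewrite -!qpoly_eval_id qpoly_evalX // root_map_id. Qed.

Lemma horner_qpoly1 : ((1 : {poly %/ p}) : {poly R}).[z] = 1.
Proof. by rewrite -!qpoly_eval_id qpoly_eval1. Qed.

Lemma horner_in_qpoly (g : {poly R}) : (in_qpoly p g : {poly R}).[z] = g.[z].
Proof. by rewrite -qpoly_eval_id qpoly_eval_in ?root_map_id // map_poly_id. Qed.

End HornerAtRoot.

(** A residue has degree less than the number of roots, so a nonzero difference cannot vanish at all
    of them. *)
Lemma qpoly_horner_inj (R : idomainType) (p : {poly R}) (rs : seq R)
    (rs_uniq : uniq rs) (pE : p = \prod_(z <- rs) ('X - z%:P))
    (p_gt1 : (1 < size p)%N) (x y : {poly %/ p}) :
  (forall z, z \in rs -> (x : {poly R}).[z] = (y : {poly R}).[z]) -> x = y.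
Proof.
have p_mon : p \is monic by rewrite pE monic_prod_XsubC.
move=> xy; apply: val_inj => /=; apply/eqP; rewrite -subr_eq0; apply/negP => /negP nz.
have := max_poly_roots nz (rs := rs); rewrite rs_uniq => /(_ _ isT).
have -> : all (root ((x : {poly R}) - y)) rs.
  by apply/allP => z zr; rewrite rootE hornerD hornerN xy // subrr.
move=> /(_ isT); apply/negP; rewrite -leqNgt.
apply: leq_trans (size_polyD _ _) _; rewrite size_polyN geq_max.
have sz : size p = (size rs).+1 by rewrite pE size_prod_XsubC.
by apply/andP; split; rewrite -ltnS -sz size_qpoly.
Qed.

(** * Powers of Frobenius on a field containing F *)

Section FrobeniusPower.

Variables (F : finFieldType) (K : fieldType) (iota : {rmorphism F -> K}).
Local Notation q := #|F|.

Lemma card_pnat : [pchar K].-nat q.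
Proof.
have [l l_pr lF] := finPcharP F.
have lK : l \in [pchar K] by rewrite (fmorph_pchar iota).
rewrite (eq_pnat _ (pcharf_eq lK)) -cardsT.
by case/and3P: (fin_ring_pchar_abelem lF).
Qed.

Lemma frobD k (x y : K) : (x + y) ^+ (q ^ k) = x ^+ (q ^ k) + y ^+ (q ^ k).
Proof. by apply: exprDn_pchar; rewrite pnatX card_pnat. Qed.

Lemma frob_morphism : exists s : {rmorphism K -> K}, forall x, s x = x ^+ q.
Proof.
pose s (x : K) := x ^+ q.
have sB : zmod_morphism s.
  move=> x y; rewrite /s; apply/eqP; rewrite eq_sym subr_eq; apply/eqP.
  by have := frobD 1 (x - y) y; rewrite expn1 subrK.
have sM : monoid_morphism s.
  by split=> [|x y]; rewrite /s ?expr1n ?exprMn.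
exists (HB.pack_for {rmorphism K -> K} s
  (GRing.isZmodMorphism.Build K K s sB) (GRing.isMonoidMorphism.Build K K s sM)).
by [].
Qed.

Lemma frobB k (x y : K) : (x - y) ^+ (q ^ k) = x ^+ (q ^ k) - y ^+ (q ^ k).
Proof.
by apply/eqP; rewrite eq_sym subr_eq -frobD subrK.
Qed.

Lemma frob_root k (p : {poly F}) z :
  root (map_poly iota p) z -> root (map_poly iota p) (z ^+ (q ^ k)).
Proof.
elim: k => [|k IHk]; first by rewrite expn0 expr1.
have [s sE] := frob_morphism.
move=> /IHk /rootP pz; apply/rootP; rewrite expnSr exprM -sE.
have -> : map_poly iota p = map_poly s (map_poly iota p).
  rewrite -map_poly_comp; apply: eq_map_poly => x /=.
  by rewrite sE -rmorphXn expf_card.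
by rewrite horner_map pz rmorph0.
Qed.

End FrobeniusPower.

(** * Half powers of products of conjugates *)

Lemma half_exp_pred q d : odd q ->
  ((q ^ d.+1).-1./2 = q * (q ^ d).-1./2 + q.-1./2)%N.
Proof.
move=> q_odd; have q0 : (0 < q)%N by case: (q) q_odd.
have qd0 k : (0 < q ^ k)%N by rewrite expn_gt0 q0.
have ev k : ~~ odd (q ^ k).-1.
  by rewrite -[odd _]negbK -oddS prednK // oddX q_odd orbT.
apply: double_inj; rewrite doubleD doubleMr !even_halfK //.
  have := qd0 d; rewrite expnS; nia.
by have := ev 1%N; rewrite expn1.
Qed.

Lemma odd_half_exp_pred q d : odd q ->
  odd (q ^ d).-1./2 = odd d && odd q.-1./2.
Proof.
move=> q_odd; elim: d => [|d IHd]; first by rewrite expn0.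
by rewrite half_exp_pred // oddD oddM q_odd /= IHd; case: odd; case: odd.
Qed.

(** The second factor is (q^e + 1)/2. This splitting evaluates the conjugate difference with t =
    d/2, which is its own partner in the pairing. *)
Lemma half_exp_pred_double q e : odd q ->
  ((q ^ (e + e)).-1./2 = (q ^ e).-1 * ((q ^ e).-1./2).+1)%N.
Proof.
move=> q_odd; have q0 : (0 < q)%N by case: (q) q_odd.
have qd0 k : (0 < q ^ k)%N by rewrite expn_gt0 q0.
have ev k : ~~ odd (q ^ k).-1.
  by rewrite -[odd _]negbK -oddS prednK // oddX q_odd orbT.
apply: double_inj; rewrite doubleMr doubleS !even_halfK // expnD.
case: (q ^ e)%N (qd0 e) => // n _ /=.
by nia.
Qed.

Section EulerProducts.

Variables (F : finFieldType) (K : fieldType) (iota : {rmorphism F -> K}).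
Local Notation q := #|F|.
Hypothesis F_odd : 2%N \notin [pchar F].

Lemma odd_card : odd q.
Proof.
apply/negPn/negP => q_even.
have /pnatP := card_pnat (idfun : {rmorphism F -> F}).
move=> /(_ (ltnW (card_finRing_gt1 F)) 2 isT).
by rewrite dvdn2 q_even (negPf F_odd) => /(_ isT).
Qed.

Lemma odd_card_exp d : odd (q ^ d).
Proof. by rewrite oddX odd_card orbT. Qed.

Lemma card_exp_double d : ((q ^ d).-1./2.*2 = (q ^ d).-1)%N.
Proof.
rewrite even_halfK // -[odd _]negbK -oddS prednK ?odd_card_exp //.
by rewrite odd_gt0 ?odd_card_exp.
Qed.

Lemma euler_sqr d (x : K) :
  x ^+ (q ^ d) = x -> x != 0 -> x ^+ (q ^ d).-1./2 ^+ 2 = 1.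
Proof.
move=> xq x0; rewrite -exprM muln2 card_exp_double.
apply: (mulfI x0); rewrite mulr1 -exprS prednK // odd_gt0 ?odd_card_exp //.
Qed.

Lemma odd_exp_sign (x : K) k : x ^+ 2 = 1 -> odd k -> x ^+ k = x.
Proof.
move=> x2 k_odd; rewrite -(odd_double_half k) k_odd -muln2 addnC exprD.
by rewrite mulnC exprM x2 expr1n mul1r.
Qed.

Section Conjugates.

Variables (z : K) (d : nat).
Hypotheses (zq : z ^+ (q ^ d) = z)
           (z_neq : forall t, (0 < t < d)%N -> z ^+ (q ^ t) != z).

Let y t := (z - z ^+ (q ^ t)) ^+ (q ^ d).-1./2.

Let subX a t : (z - z ^+ (q ^ t)) ^+ (q ^ a) = z ^+ (q ^ a) - z ^+ (q ^ (t + a)).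
Proof. by rewrite (frobB iota) -exprM -expnD. Qed.

Let y2 t : (0 < t < d)%N -> y t ^+ 2 = 1.
Proof.
move=> t_in; apply: euler_sqr; last by rewrite subr_eq0 eq_sym z_neq.
by rewrite subX addnC expnD exprM zq.
Qed.

Let y_sym t : (0 < t < d)%N -> y (d - t) = (-1) ^+ (q ^ d).-1./2 * y t.
Proof.
move=> t_in; have t_le : (t <= d)%N by case/andP: t_in => _ /ltnW.
(* [y t] is a sign, so the odd power q^(d-t) does not change it, while the same power takes z -
   z^(q^t) to -(z - z^(q^(d-t))). *)
rewrite -(odd_exp_sign (y2 t_in) (odd_card_exp (d - t))) /y.
by rewrite -exprM mulnC exprM subX subnKC // zq -exprMn mulN1r opprB.
Qed.

Let y_pairs e : (e.*2 < d)%N ->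
  \prod_(1 <= t < e.+1) y t * \prod_(d - e <= t < d) y t
  = ((-1) ^+ (q ^ d).-1./2) ^+ e.
Proof.
elim: e => [|e IHe] ed; first by rewrite subn0 !big_geq ?mulr1.
rewrite big_nat_recr //= [X in _ * X]big_ltn; last by lia.
have -> : (d - e.+1).+1 = (d - e)%N by lia.
have -> : y (d - e.+1) = (-1) ^+ (q ^ d).-1./2 * y e.+1 by apply: y_sym; lia.
rewrite exprS -IHe; last by lia.
rewrite -[RHS]mulr1 -(@y2 e.+1); last by lia.
by ring.
Qed.

(** For odd d the factors form (d-1)/2 pairs, each contributing (-1)^((q^d - 1)/2) = (-1)^((q-1)/2).
    For even d a pair contributes 1, and only the factor t = d/2 counts. *)
Lemma prod_conj_euler : (0 < d)%N ->
  (\prod_(1 <= t < d) (z - z ^+ (q ^ t))) ^+ (q ^ d).-1./2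
  = (-1) ^+ d.-1 * ((-1) ^+ d./2) ^+ q.-1./2.
Proof.
move=> d0; rewrite -prodrXl -/(y _) /=.
have sgE k : (-1) ^+ k = (-1) ^+ odd k :> K by rewrite signr_odd.
set e := d./2; have dE := odd_double_half d; rewrite -/e in dE.
case d_odd: (odd d) in dE.
  rewrite (@big_cat_nat _ _ _ e.+1) //=; [|lia..].
  have -> : \prod_(e.+1 <= t < d) y t = \prod_(d - e <= t < d) y t.
    by congr bigop; congr index_iota; lia.
  rewrite y_pairs; last by lia.
  rewrite [X in X ^+ e]sgE odd_half_exp_pred ?odd_card // d_odd.
  rewrite [X in _ = _ * X]exprAC [(-1) ^+ q.-1./2]sgE.
  rewrite [X in X * _]sgE; have -> : odd d.-1 = false by lia.
  by rewrite mul1r.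
have e0 : (0 < e)%N by lia.
have dee : d = (e + e)%N by lia.
rewrite (@big_cat_nat _ _ _ e) //=; [|lia..].
rewrite [X in _ * X]big_ltn; last by lia.
have -> : \prod_(1 <= t < e) y t * (y e * \prod_(e.+1 <= t < d) y t) =
  y e * (\prod_(1 <= t < e.-1.+1) y t * \prod_(d - e.-1 <= t < d) y t).
  rewrite prednK //; have -> : (d - e.-1 = e.+1)%N by lia.
  by ring.
rewrite y_pairs; last by lia.
rewrite [X in X ^+ e.-1]sgE odd_half_exp_pred ?odd_card // d_odd expr1n mulr1.
have xe0 : z - z ^+ (q ^ e) != 0 by rewrite subr_eq0 eq_sym z_neq //; lia.
(* The q^e-power negates the middle factor, so its Euler power is (-1)^((q^e + 1)/2). The excess of
   (q^e + 1)/2 over (q^e - 1)/2 produces the sign (-1)^(d-1). *)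
have xqe : (z - z ^+ (q ^ e)) ^+ (q ^ e).-1 = -1.
  apply: (mulfI xe0); rewrite -exprS prednK ?odd_gt0 ?odd_card_exp //.
  by rewrite subX -dee zq mulrN1 opprB.
have hE : ((q ^ d).-1./2 = (q ^ e).-1 * ((q ^ e).-1./2).+1)%N.
  by rewrite -half_exp_pred_double ?odd_card -?dee.
rewrite /y hE exprM xqe exprS.
rewrite [X in -1 * X]sgE odd_half_exp_pred ?odd_card //.
rewrite [X in _ = X * _]sgE; have -> : odd d.-1 by lia.
rewrite expr1; congr (_ * _).
by rewrite -exprM [RHS]sgE oddM.
Qed.

End Conjugates.

(** The compositum has degree r = e/gcd(d,e) over the field of degree d, and its Euler exponent is
    that of the smaller field times the exponent of the norm. The norm of z - w^(q^t) is the product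
    of the z - w^(q^(t+dk)) for k < r; letting t run below the gcd exhausts the conjugates of w. *)
Lemma prod_cross_euler (z w : K) d e :
  (0 < d)%N -> (0 < e)%N -> z ^+ (q ^ d) = z -> w ^+ (q ^ e) = w ->
  (\prod_(s < e) (z - w ^+ (q ^ s))) ^+ (q ^ d).-1./2
  = \prod_(1 <= t < (gcdn d e).+1)
      (z - w ^+ (q ^ t.-1)) ^+ (q ^ lcmn d e).-1./2.
Proof.
move=> d0 e0 zq wq; set g := gcdn d e.
have g0 : (0 < g)%N by rewrite gcdn_gt0 d0.
set r := (e %/ g)%N.
have eE : (r * g = e)%N by rewrite divnK ?dvdn_gcdr.
have r0 : (0 < r)%N by rewrite -(ltn_pmul2r g0) mul0n eE.
have lE : (lcmn d e = d * r)%N.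
  by rewrite /lcmn -/g muln_divA // dvdn_gcdr.
have halfE : ((q ^ lcmn d e).-1./2 = (q ^ d).-1./2 * \sum_(k < r) q ^ (d * k))%N.
  rewrite lE; apply: double_inj; rewrite card_exp_double -muln2 mulnAC muln2.
  rewrite card_exp_double expnM predn_exp; congr muln.
  by apply: eq_bigr => k _; rewrite expnM.
rewrite big_add1 /= big_mkord.
under [RHS]eq_bigr => t _.
  rewrite halfE mulnC exprM -prodrXr.
  under eq_bigr => k _.
    have -> : (z - w ^+ (q ^ t)) ^+ (q ^ (d * k)) = z - w ^+ (q ^ ((t + d * k) %% e)).
      rewrite (frobB iota); congr (_ - _).
        elim: (val k) => [|j IHj]; first by rewrite muln0 expn0 expr1.
        by rewrite mulnS expnD exprM zq IHj.
      rewrite -exprM -expnD {1}(divn_eq (t + d * k) e) expnD exprM.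
      congr (_ ^+ _); elim: (_ %/ e)%N => [|j IHj]; first by rewrite mul0n expn0 expr1.
      by rewrite mulSn expnD exprM wq IHj.
    over.
  over.
rewrite prodrXl; congr (_ ^+ _).
rewrite pair_bigA /=.
have h_lt (u : 'I_g * 'I_r) : ((u.1 + d * u.2) %% e < e)%N by rewrite ltn_mod.
pose h u := Ordinal (h_lt u).
rewrite (reindex h); first by [].
(* Injectivity of (t, k) -> t + dk mod e: reducing modulo g recovers t; then r divides (d/g)(k' - k)
   with d/g prime to r, which forces k = k'. *)
apply: onW_bij; apply: inj_card_bij; last by rewrite card_prod !card_ord -eE mulnC.
move=> [t k] [t' k'] /(congr1 val) /= /eqP hE.
have tt' : t = t'.
  apply: val_inj => /=; move/eqP: hE => /(congr1 (modn^~ g)).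
  rewrite !modn_dvdm ?dvdn_gcdr // -/g.
  have dvd_g : (g %| d)%N by rewrite dvdn_gcdl.
  have mod_g i j : ((i + d * j) %% g = i %% g)%N.
    by rewrite -(divnK dvd_g) mulnAC addnC modnMDl.
  by rewrite !mod_g !modn_small.
move: hE; rewrite {}tt' eqn_modDl => hE; congr pair; apply: val_inj => /=.
have le_case (i j : 'I_r) : (i <= j)%N -> d * i == d * j %[mod e] -> i = j :> nat.
  move=> ij; rewrite eq_sym eqn_mod_dvd ?leq_mul2l ?ij ?orbT // -mulnBr.
  rewrite -eE -(divnK (dvdn_gcdl d e)) -/g mulnAC dvdn_pmul2r //.
  rewrite Gauss_dvdr; last first.
    by rewrite /coprime gcdnC -(eqn_pmul2r g0) muln_gcdl eE divnK ?dvdn_gcdl ?mul1n.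
  case: (posnP (j - i)) => [/eqP|ji0 /(dvdn_leq ji0)].
    by rewrite subn_eq0 => ji _; apply/eqP; rewrite eqn_leq ij.
  by have := ltn_ord j; lia.
case: (leqP k k') => [kk|/ltnW kk]; first exact: le_case.
by apply/esym/le_case; rewrite // eq_sym.
Qed.

End EulerProducts.

(** * Quadratic characters and Kummer classes *)

Lemma odd_pchar (F K : fieldType) (f : {rmorphism F -> K}) :
  (2%:R : K) != 0 -> 2%N \notin [pchar F].
Proof.
move=> K2; rewrite -(fmorph_pchar f).
by apply/negP => /pcharf0/eqP; rewrite (negPf K2).
Qed.

Section QuadChar.

Variable K : closedFieldType.
Hypothesis K_odd : (2%:R : K) != 0.

Lemma closed_sqrt (x : K) : exists y, y ^+ 2 = x.
Proof.
have [y] := @solve_monicpoly K 2 (fun i => if i == 0%N then x else 0) isT.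
by rewrite !big_ord_recl big_ord0 /= expr0 mulr1 mul0r !addr0 => yE; exists y.
Qed.

(** K contains a square root y of z, and for z nonzero y lies in [S] iff y^(Q-1) = 1 iff z^((Q-1)/2)
    = 1. Euler's criterion thus needs no cyclic multiplicative group. *)
Lemma quad_char_fixed (Q : nat) (S : {pred K}) (z : K) :
  odd Q -> (1 < Q)%N -> (forall y, (y \in S) = (y ^+ Q == y)) -> z \in S ->
  (quad_char S z)%:~R = z ^+ Q.-1./2.
Proof.
move=> Q_odd Q1 SE zS; have Q2 : (0 < Q.-1./2)%N by lia.
rewrite /quad_char; case: eqP => [->|/eqP z0].
  by rewrite expr0n eqn0Ngt Q2.
have Qh : (2 * Q.-1./2 = Q.-1)%N by lia.
have S_sqr y : y ^+ 2 = z -> (y \in S) = (z ^+ Q.-1./2 == 1).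
  move=> yz; have y0 : y != 0.
    by apply: contra_neq z0 => y0; rewrite -yz y0 expr0n.
  rewrite SE -yz -exprM Qh -(inj_eq (mulfI y0) _ 1) mulr1 -exprS prednK //.
  exact: ltnW.
have [y yz] := closed_sqrt z.
case: boolp.asboolP => [[x xS xz]|nS]; first by apply/esym/eqP; rewrite -(S_sqr x).
have : z ^+ Q.-1./2 != 1.
  by rewrite -(S_sqr y yz); apply/negP => yS; apply: nS; exists y.
have : z ^+ Q.-1./2 ^+ 2 = 1.
  rewrite -exprM mulnC Qh; apply: (mulfI z0); rewrite -exprS mulr1.
  by apply/eqP; rewrite prednK -?SE // ltnW.
by move/eqP; rewrite sqrf_eq1 => /orP[->|/eqP->].
Qed.

Lemma quad_char_sqr (R : nzRingType) (S : {pred R}) (x : R) :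
  x != 0 -> quad_char S x ^+ 2 = 1.
Proof. by rewrite /quad_char => /negPf->; case: boolp.asboolP. Qed.

Lemma sign_intr_inj (a b : int) :
  a ^+ 2 = 1 -> b ^+ 2 = 1 -> a%:~R = b%:~R :> K -> a = b.
Proof.
have ne : 1 != -1 :> K by rewrite -subr_eq0 opprK -mulr2n.
move=> /eqP; rewrite sqrf_eq1 => /orP[]/eqP->;
  move=> /eqP; rewrite sqrf_eq1 => /orP[]/eqP->; rewrite ?mulrNz // => /eqP.
  by rewrite (negPf ne).
by rewrite eq_sym (negPf ne).
Qed.

Lemma quad_char_fin (L : finFieldType) (f : {rmorphism L -> K}) (x : L) :
  (quad_char predT x)%:~R = f x ^+ #|L|.-1./2.
Proof.
have L_odd := odd_pchar f K_odd.
pose S : {pred K} := [pred y | y ^+ #|L| == y].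
(* The image of L already exhausts the roots of X^|L| - X, so being a square in L is the same as
   being a square in the fixed set [S]. *)
have SE y : y ^+ #|L| = y -> exists x, f x = y.
  move=> yS; apply: boolp.contrapT => nE.
  pose rs := y :: [seq f x | x <- enum L].
  have := @max_poly_roots K ('X^#|L| - 'X) rs.
  have sz : size ('X^#|L| - 'X : {poly K}) = #|L|.+1.
    by rewrite size_polyDl ?size_polyN size_polyXn ?size_polyX // ltnS card_finRing_gt1.
  rewrite -size_poly_eq0 sz /= size_map -cardE ltnn => H.
  suff : false by []; apply: H => //.
    rewrite rootE !hornerE yS subrr eqxx /=.
    by apply/allP => _ /mapP[w _ ->]; rewrite rootE !hornerE -rmorphXn expf_card subrr.
  rewrite (map_inj_uniq (fmorph_inj f)) enum_uniq andbT.
  by apply/mapP => -[w _ yw]; apply: nE; exists w.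
have fS w : f w \in S by rewrite inE -rmorphXn expf_card.
rewrite -(@quad_char_fixed #|L| S) ?odd_card ?card_finRing_gt1 //.
congr (_%:~R); rewrite /quad_char fmorph_eq0; case: ifP => // _.
congr (if _ then _ else _); apply: boolp.asbool_equiv_eq; split=> -[y yS yx].
  by exists (f y); rewrite ?fS // -rmorphXn yx.
have [w wy] := SE y (eqP yS); exists w => //.
by apply: (fmorph_inj f); rewrite rmorphXn wy.
Qed.

End QuadChar.

(** * Roots of a monic irreducible polynomial over F *)

Section IrreducibleRoots.

Variables (F : finFieldType) (K : closedFieldType) (iota : {rmorphism F -> K}).
Local Notation q := #|F|.
Variable p : {poly F}.
Hypothesis p_irr : monic_irreducible_poly p.
Local Notation pK := (map_poly iota p).
Local Notation d := (size p).-1.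

Lemma irr_monic : p \is monic. Proof. exact: p_irr.2. Qed.
Lemma irr_size : (1 < size p)%N. Proof. exact: p_irr.1.1. Qed.

Lemma irr_deg_gt0 : (0 < d)%N. Proof. by have := irr_size; case: size => [|[]]. Qed.

(** The type [{poly %/ p with p_irr}] carries the field structure; a morphism out of it is injective
    and transports x^(q^d) = x to K. *)
Lemma irr_eval_morphism z : root pK z ->
  exists f : {rmorphism {poly %/ p with p_irr} -> K}, f =1 qpoly_eval iota z.
Proof.
move=> pz; pose f : {poly %/ p with p_irr} -> K := qpoly_eval iota z.
have fD : nmod_morphism f.
  split; first exact: qpoly_eval0.
  exact: (@qpoly_evalD _ _ iota p z).
have fM : monoid_morphism f.
  by split; [exact: qpoly_eval1 | exact: (@qpoly_evalM _ _ iota p irr_monic irr_size z pz)].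
by exists (HB.pack_for {rmorphism {poly %/ p with p_irr} -> K} f
  (GRing.isNmodMorphism.Build _ _ f fD) (GRing.isMonoidMorphism.Build _ _ f fM)).
Qed.

Lemma horner_frob (g : {poly F}) z k :
  (map_poly iota g).[z] ^+ (q ^ k) = (map_poly iota g).[z ^+ (q ^ k)].
Proof.
elim: k => [|k IHk]; first by rewrite expn0 !expr1.
have [s sE] := frob_morphism iota.
rewrite expnSr !exprM IHk -sE -horner_map /= sE; congr (_.[_]).
by rewrite -map_poly_comp; apply: eq_map_poly => x /=; rewrite sE -rmorphXn expf_card.
Qed.

Lemma card_irr : #|{poly %/ p with p_irr}| = (q ^ d)%N.
Proof. exact: card_qfpoly. Qed.

Lemma irr_eval_frob z (pz : root pK z) (x : {poly %/ p}) :
  qpoly_eval iota z x ^+ (q ^ d) = qpoly_eval iota z x.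
Proof.
have [f fE] := irr_eval_morphism pz.
by rewrite -fE -card_irr -rmorphXn expf_card.
Qed.

Lemma irr_root_frob z : root pK z -> z ^+ (q ^ d) = z.
Proof.
move=> pz; have := irr_eval_frob pz 'qX.
by rewrite qpoly_eval_in ?irr_monic ?irr_size // map_polyX hornerX.
Qed.

(** Otherwise the q^t-power would fix the whole image of F[T]/(p), giving X^(q^t) - X as many as q^d
    roots. *)
Lemma irr_root_neq z t : root pK z -> (0 < t < d)%N -> z ^+ (q ^ t) != z.
Proof.
move=> pz /andP[t0 td]; apply/eqP => zt.
have [f fE] := irr_eval_morphism pz.
pose rs := [seq f x | x <- enum {poly %/ p with p_irr}].
have q1 : (1 < q)%N by apply: card_finRing_gt1.
have qt1 : (1 < q ^ t)%N by rewrite -{1}(expn0 q) ltn_exp2l.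
have sz : size ('X^(q ^ t) - 'X : {poly K}) = (q ^ t).+1.
  by rewrite size_polyDl ?size_polyN size_polyXn ?size_polyX.
have := @max_poly_roots K ('X^(q ^ t) - 'X) rs.
rewrite -size_poly_eq0 sz /= size_map -cardE card_irr ltnS leqNgt ltn_exp2l // td => H.
suff : false by []; apply: H => //.
  apply/allP => _ /mapP[w _ ->]; rewrite rootE !hornerE fE.
  by rewrite /qpoly_eval horner_frob zt subrr.
by rewrite (map_inj_uniq (fmorph_inj f)) enum_uniq.
Qed.

Definition conj_roots (z : K) : seq K := [seq z ^+ (q ^ s) | s <- index_iota 0 d].

Lemma size_conj_roots z : size (conj_roots z) = d.
Proof. by rewrite size_map size_iota subn0. Qed.

Lemma conj_roots_uniq z : root pK z -> uniq (conj_roots z).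
Proof.
move=> pz; rewrite map_inj_in_uniq ?iota_uniq //.
have lt_case s t : (s < t < d)%N -> z ^+ (q ^ s) = z ^+ (q ^ t) -> s = t.
  move=> /andP[st td] zst; have := @irr_root_neq (z ^+ (q ^ s)) (t - s).
  rewrite frob_root // => /(_ isT); rewrite -exprM -expnD subnKC ?(ltnW st) // zst.
  by rewrite eqxx => H; have : false by apply: H; lia.
move=> s t; rewrite !mem_index_iota /= => sd td zst.
case: (ltngtP s t) => // st; first by apply: lt_case; rewrite ?st.
by apply/esym/lt_case; rewrite ?st.
Qed.

Lemma irr_prod_roots z : root pK z ->
  pK = \prod_(w <- conj_roots z) ('X - w%:P).
Proof.
move=> pz; have p_mon : pK \is monic by rewrite map_monic irr_monic.
rewrite {1}(@all_roots_prod_XsubC _ pK (conj_roots z)).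
- by rewrite (monicP p_mon) scale1r.
- by rewrite size_map_poly size_conj_roots prednK // ltnW ?irr_size.
- by apply/allP => _ /mapP[s _ ->]; apply: frob_root.
- by rewrite uniq_rootsE conj_roots_uniq.
Qed.

Lemma mem_conj_roots z w : root pK z -> (w \in conj_roots z) = root pK w.
Proof. by move=> pz; rewrite [in RHS](irr_prod_roots pz) root_prod_XsubC. Qed.

Lemma irr_has_root : exists z, root pK z.
Proof.
have [rs rsE] := closed_field_poly_normal pK.
case: rs rsE => [|z rs] pE.
  have := irr_size; rewrite -(size_map_poly iota) pE big_nil alg_polyC.
  by move=> H; have := leq_trans H (size_polyC_leq1 _).
by exists z; rewrite pE rootE big_cons hornerZ hornerM hornerXsubC subrr mul0r mulr0.
Qed.

Lemma map_irr_monic : pK \is monic.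
Proof. by rewrite map_monic irr_monic. Qed.

Lemma map_irr_size : (1 < size pK)%N.
Proof. by rewrite size_map_poly irr_size. Qed.

Lemma irr_qpoly_inj (x y : {poly %/ pK}) :
  (forall w, root pK w -> (x : {poly K}).[w] = (y : {poly K}).[w]) -> x = y.
Proof.
have [z pz] := irr_has_root => xy.
apply: (qpoly_horner_inj (conj_roots_uniq pz) (irr_prod_roots pz) map_irr_size).
by move=> w; rewrite mem_conj_roots // => /xy.
Qed.

Lemma map_qpoly_unit (x : {poly %/ p}) :
  x \is a GRing.unit -> in_qpoly pK (map_poly iota x) \is a GRing.unit.
Proof.
move=> x_unit; have pM := map_irr_monic; have pS := map_irr_size.
pose h (y : {poly %/ p}) := in_qpoly pK (map_poly iota y).
have hM y y' : h y * h y' = h (y * y').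
  apply: irr_qpoly_inj => w pw.
  rewrite horner_qpolyM // !horner_in_qpoly //.
  by rewrite -[RHS]/(qpoly_eval iota w (y * y')) (qpoly_evalM irr_monic irr_size pw).
have h1 : h 1 = 1.
  apply: irr_qpoly_inj => w pw; rewrite horner_in_qpoly // horner_qpoly1 //.
  exact: qpoly_eval1.
by apply/unitrP; exists (h x^-1); rewrite -/(h _) !hM mulVr ?mulrV ?h1.
Qed.

Lemma irr_eval_eq0 z (x : {poly %/ p}) :
  root pK z -> (qpoly_eval iota z x == 0) = (x == 0).
Proof.
by move=> pz; have [f fE] := irr_eval_morphism pz; rewrite -fE fmorph_eq0.
Qed.

Lemma irr_unit (x : {poly %/ p}) : (x \is a GRing.unit) = (x != 0).
Proof. exact: (@unitfE {poly %/ p with p_irr} x). Qed.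

Lemma irr_deriv z : root pK z ->
  (map_poly iota p^`()).[z] = \prod_(1 <= s < d) (z - z ^+ (q ^ s)).
Proof.
move=> pz; rewrite -deriv_map (irr_prod_roots pz) /conj_roots.
rewrite /index_iota subn0 -{1}(prednK irr_deg_gt0) /= big_cons expr1 derivM.
rewrite derivXsubC mul1r hornerD [X in _ + X]hornerM hornerXsubC subrr mul0r addr0.
rewrite horner_prod big_map /index_iota subn1.
by apply: eq_bigr => s _; rewrite hornerXsubC.
Qed.

Hypothesis K_odd : (2%:R : K) != 0.

Lemma quad_char_irr z (x : {poly %/ p}) : root pK z ->
  (quad_char predT x)%:~R = qpoly_eval iota z x ^+ (q ^ d).-1./2.
Proof.
move=> pz; have [f fE] := irr_eval_morphism pz.
by rewrite -fE -card_irr -quad_char_fin.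
Qed.

(* If b^2 = alpha, the relation sigma(b) = c b (up to a coboundary of signs)  *)
(* telescopes over the conjugates of z to b(z)^(q^d) = b(z) * norm of c.      *)
Lemma kummer_quad_char (s : {rmorphism K -> K}) (c : {rmorphism K -> K} -> {poly %/ pK})
    (alpha : {unit {poly %/ p}}) z :
  (forall x, s x = x ^+ q) -> galois_aut iota s -> c s ^+ 2 = 1 -> root pK z ->
  kummer_class c alpha ->
  (quad_char predT (val alpha))%:~R = \prod_(t < d) (c s : {poly K}).[z ^+ (q ^ t)].
Proof.
move=> sE s_gal c2 pz [b b2 [e e2 ce]].
have pM := map_irr_monic; have pS := map_irr_size.
have pzt t : root pK (z ^+ (q ^ t)) by apply: frob_root.
have b_unit : b \is a GRing.unit.
  by rewrite -(unitrX_pos _ (isT : 0 < 2)%N) b2 map_qpoly_unit ?(valP alpha).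
have e_unit : e \is a GRing.unit.
  by rewrite -(unitrX_pos _ (isT : 0 < 2)%N) e2 unitr1.
have ev_e x : root pK x -> (e : {poly K}).[x] ^+ 2 = 1.
  by move=> px; rewrite -horner_qpolyX // e2 horner_qpoly1.
have ev_c x : root pK x -> (c s : {poly K}).[x] ^+ 2 = 1.
  by move=> px; rewrite -horner_qpolyX // c2 horner_qpoly1.
have act_ev (r : {poly %/ pK}) x : root pK x ->
    (galois_act s r : {poly K}).[x ^+ q] = (r : {poly K}).[x] ^+ q.
  move=> px; rewrite /galois_act horner_in_qpoly //; last first.
    by have := frob_root 1 px; rewrite expn1.
  by rewrite -!sE horner_map.
pose bt t := (b : {poly K}).[z ^+ (q ^ t)].
pose ct t := (c s : {poly K}).[z ^+ (q ^ t)].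
pose et t := (e : {poly K}).[z ^+ (q ^ t)].
have step t : et t.+1 * bt t ^+ q = bt t.+1 * ct t.+1 * et t ^+ q.
  have ceE : e * galois_act s b = b * c s * galois_act s e.
    rewrite -[galois_act s b](mulVKr b_unit) (ce s s_gal).
    have rot x y : e * (b * (c s * (x * y))) = b * c s * y * (e * x) by ring.
    by rewrite rot mulrV // mulr1.
  have : ((e * galois_act s b : {poly %/ pK}) : {poly K}).[z ^+ (q ^ t.+1)]
      = ((b * c s * galois_act s e : {poly %/ pK}) : {poly K}).[z ^+ (q ^ t.+1)].
    by rewrite ceE.
  rewrite !horner_qpolyM // /et /bt /ct expnSr exprM !act_ev //.
have et2 t : et t ^+ 2 = 1 by apply: ev_e.
have ct2 t : ct t ^+ 2 = 1 by apply: ev_c.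
(* The coboundary enters only through [et 0 * et t], which becomes a square when the orbit closes at
   t = d. *)
have btE t : bt 0%N ^+ (q ^ t) = bt t * (\prod_(1 <= u < t.+1) ct u) * (et 0%N * et t).
  elim: t => [|t IHt].
    by rewrite expn0 expr1 big_geq // -expr2 et2 !mulr1.
  have q_odd : odd q by apply/odd_card/(odd_pchar iota).
  rewrite expnSr exprM IHt !exprMn !(odd_exp_sign (et2 _) q_odd) -prodrXl.
  rewrite (eq_bigr ct) => [|u _]; last exact: odd_exp_sign (ct2 u) q_odd.
  rewrite [in RHS]big_nat_recr //=.
  have -> : bt t ^+ q = et t.+1 * (bt t.+1 * ct t.+1 * et t).
    by rewrite -[X in _ * (_ * X)](odd_exp_sign (et2 t) q_odd) -step mulrA -expr2 et2 mul1r.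
  by rewrite -[RHS]mulr1 -(et2 t); ring.
have zd : z ^+ (q ^ d) = z := irr_root_frob pz.
have b0 : bt 0%N != 0.
  apply/eqP => b0; have := horner_qpoly1 pK z.
  rewrite -(mulrV b_unit) horner_qpolyM //; move: b0; rewrite /bt expn0 expr1 => ->.
  by rewrite mul0r => /esym/eqP; rewrite oner_eq0.
have := btE d.
have -> : bt d = bt 0%N by rewrite /bt zd expn0 expr1.
have -> : et d = et 0%N by rewrite /et zd expn0 expr1.
rewrite -expr2 et2 mulr1.
have qd0 : (0 < q ^ d)%N by rewrite expn_gt0 ltnW ?card_finRing_gt1.
rewrite -{1}(prednK qd0) exprS => /(mulfI b0) bE.
rewrite (quad_char_irr _ pz).
have -> : qpoly_eval iota z (val alpha) = bt 0%N ^+ 2.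
  by rewrite /bt -horner_qpolyX // b2 horner_in_qpoly // expn0 expr1.
have F_odd := odd_pchar iota K_odd.
rewrite -exprM mul2n card_exp_double // bE -(big_mkord xpredT ct).
(* The telescoped product runs over 1, ..., d; as [ct d = ct 0], it equals the product over 0, ...,
   d-1. *)
have ct0 : ct 0%N != 0.
  by apply: contra_eq_neq (ct2 0%N) => ->; rewrite expr0n eq_sym oner_eq0.
apply: (mulfI ct0); rewrite -big_ltn // big_nat_recr //= mulrC; congr (_ * _).
by rewrite /ct zd expn0 expr1.
Qed.

End IrreducibleRoots.

Lemma quad_char_subfield (F : finFieldType) (K : closedFieldType)
    (iota : {rmorphism F -> K}) (K_odd : (2%:R : K) != 0) d (x : K) :
  (0 < d)%N -> x ^+ (#|F| ^ d) = x ->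
  (quad_char (degree_subfield F (K := K) d) x)%:~R = x ^+ (#|F| ^ d).-1./2.
Proof.
move=> d0 xd; have F_odd := odd_pchar iota K_odd.
apply: quad_char_fixed => //; first exact: odd_card_exp.
  by rewrite -{1}(expn0 #|F|) ltn_exp2l ?card_finRing_gt1.
by rewrite inE xd.
Qed.

Lemma frob_fixed_dvd (R : nzRingType) (q : nat) (z : R) d l :
  (d %| l)%N -> z ^+ (q ^ d) = z -> z ^+ (q ^ l) = z.
Proof.
move=> /dvdnP[k ->] zd; elim: k => [|k IHk]; first by rewrite mul0n expn0 expr1.
by rewrite mulSn expnD exprM zd.
Qed.

(** * The quadratic character in terms of the roots *)

Section QuadCharFormula.

Variables (F : finFieldType) (K : closedFieldType) (iota : {rmorphism F -> K}).
Local Notation q := #|F|.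
Hypothesis K_odd : (2%:R : K) != 0.
Variables (m : nat) (p : 'I_m -> {poly F}).
Hypothesis p_irr : forall i, monic_irreducible_poly (p i).
Variable delta : 'I_m -> K.
Hypothesis delta_root : forall i, root (map_poly iota (p i)) (delta i).
Local Notation d i := (size (p i)).-1.
Local Notation E k := (q ^ k).-1./2.

Lemma quad_char_formula i (eta alpha : {poly %/ p i}) :
  eta != 0 -> alpha != 0 ->
  (forall j, j != i -> ~~ root (map_poly iota (p j)) (delta i)) ->
  qpoly_eval iota (delta i) alpha
    * \prod_(j | j != i) (map_poly iota (p j)).[delta i]
  = qpoly_eval iota (delta i) eta * (map_poly iota (p i)^`()).[delta i] ->
  quad_char predT alpha
  = (-1) ^+ (d i).-1
    * quad_char predT ((-1) ^+ (d i)./2 : F)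
    * quad_char predT eta
    * \prod_(j | j != i) \prod_(1 <= t < (gcdn (d i) (d j)).+1)
        quad_char (degree_subfield F (K := K) (lcmn (d i) (d j)))
          (delta i - delta j ^+ (q ^ t.-1)).
Proof.
move=> eta0 alpha0 coprime_p alphaE.
have F_odd := odd_pchar iota K_odd.
have di0 k : (0 < d k)%N := irr_deg_gt0 (p_irr k).
have dq k : delta k ^+ (q ^ d k) = delta k by apply: irr_root_frob.
have sub_neq0 j t : j != i -> delta i - delta j ^+ (q ^ t) != 0.
  move=> ji; rewrite subr_eq0; apply: contraNneq (coprime_p j ji) => ->.
  exact: frob_root.
apply: (@sign_intr_inj K) => //; first exact: quad_char_sqr.
  rewrite !exprMn sqrr_sign mul1r.
  rewrite !quad_char_sqr ?signr_eq0 // !mul1r -prodrXl big1 // => j ji.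
  rewrite -prodrXl big_nat big1 // => t _.
  by rewrite quad_char_sqr // sub_neq0.
rewrite !rmorphM /= rmorphXn rmorphN1 /= (quad_char_fin K_odd iota).
rewrite !(quad_char_irr (p_irr i) K_odd _ (delta_root i)).
rewrite rmorphXn rmorphN1.
have pjE j : j != i -> ((map_poly iota (p j)).[delta i]) ^+ E (d i) =
  (\prod_(1 <= t < (gcdn (d i) (d j)).+1)
        quad_char (degree_subfield F (K := K) (lcmn (d i) (d j)))
          (delta i - delta j ^+ (q ^ t.-1)))%:~R.
  move=> ji; rewrite (irr_prod_roots (p_irr j) (delta_root j)) /conj_roots.
  rewrite big_map horner_prod big_mkord.
  under [in LHS]eq_bigr do rewrite hornerXsubC.
  rewrite (prod_cross_euler iota) // rmorph_prod; apply: eq_bigr => t _ /=.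
  rewrite (quad_char_subfield iota) //; first by rewrite lcmn_gt0 !di0.
  rewrite (frobB iota) exprAC.
  by rewrite (frob_fixed_dvd (dvdn_lcml _ (d j)) (dq i))
       (frob_fixed_dvd (dvdn_lcmr (d i) _) (dq j)).
have := congr1 (fun x => x ^+ E (d i)) alphaE.
rewrite /= !exprMn irr_deriv // prod_conj_euler //; last first.
  by move=> t; apply: (irr_root_neq (p_irr i) (delta_root i)).
rewrite -prodrXl (eq_bigr _ pjE) -(rmorph_prod intr) /=.
set P := \prod_(j | j != i) _; have P2 : P%:~R ^+ 2 = 1 :> K.
  rewrite -rmorphXn -prodrXl big1 // => j ji.
  rewrite -prodrXl big_nat big1 // => t _.
  by rewrite quad_char_sqr // sub_neq0.
(* The p_j stand on the side of [alpha]; their joint character [P] is a sign, hence its own inverse,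
   and can be moved across. *)
move=> /(congr1 (fun x => x * P%:~R)).
rewrite /= -[X in X = _ -> _]mulrA -expr2 P2 mulr1 => ->.
by ring.
Qed.

End QuadCharFormula.

(** * Orthogonal diagonalization of self-adjoint matrices *)

Section AntidiagMatrix.

Variables (R : comUnitRingType) (n : nat).

Definition antidiag_mx : 'M[R]_n := \matrix_(i, j) (j == rev_ord i)%:R.

Lemma antidiag_mul k (y : 'M[R]_(n, k)) i j :
  (antidiag_mx *m y) i j = y (rev_ord i) j.
Proof.
rewrite mxE (bigD1 (rev_ord i)) //= mxE eqxx mul1r big1 ?addr0 // => l li.
by rewrite mxE (negPf li) mul0r.
Qed.

Lemma antidiag_formE (x y : 'cV[R]_n) :
  antidiag_form x y = (x^T *m antidiag_mx *m y) 0 0.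
Proof.
rewrite -mulmxA mxE; apply: eq_bigr => i _.
by rewrite antidiag_mul mxE.
Qed.

Lemma antidiag_tr : antidiag_mx^T = antidiag_mx.
Proof.
apply/matrixP => i j; rewrite !mxE; congr (_%:R).
by rewrite -(inj_eq rev_ord_inj) rev_ordK eq_sym.
Qed.

Lemma antidiag_sqr : antidiag_mx *m antidiag_mx = 1%:M.
Proof.
apply/matrixP => i j; rewrite antidiag_mul !mxE rev_ordK; congr (_%:R).
by rewrite eq_sym.
Qed.

Lemma bilinear_mx_ext (B C : 'M[R]_n) :
  (forall x y : 'cV[R]_n, (x^T *m B *m y) 0 0 = (x^T *m C *m y) 0 0) -> B = C.
Proof.
move=> BC; apply/matrixP => i j; have := BC (delta_mx i 0) (delta_mx j 0).
by rewrite !trmx_delta -!rowE -!colE !mxE.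
Qed.

Lemma self_adjoint_mx (A : 'M[R]_n) :
  self_adjoint A <-> A^T *m antidiag_mx = antidiag_mx *m A.
Proof.
split=> [A_sa|AJ x y].
  apply: bilinear_mx_ext => x y; have := A_sa x y.
  by rewrite !antidiag_formE trmx_mul !mulmxA.
by rewrite !antidiag_formE trmx_mul -(mulmxA _ A^T) AJ !mulmxA.
Qed.

Lemma isometry_mx (g : 'M[R]_n) :
  g^T *m antidiag_mx *m g = antidiag_mx ->
  forall x y, antidiag_form (g *m x) (g *m y) = antidiag_form x y.
Proof. by move=> gJ x y; rewrite !antidiag_formE trmx_mul !mulmxA -!(mulmxA x^T) gJ. Qed.

Lemma antidiag_formC (x y : 'cV[R]_n) : antidiag_form x y = antidiag_form y x.
Proof.
rewrite /antidiag_form (reindex_inj rev_ord_inj); apply: eq_bigr => i _.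
by rewrite rev_ordK mulrC.
Qed.

End AntidiagMatrix.

Arguments antidiag_mx {R n}.

Lemma map_antidiag_mx (R S : comUnitRingType) (f : {rmorphism R -> S}) n :
  map_mx f (@antidiag_mx R n) = antidiag_mx.
Proof. by apply/matrixP => i j; rewrite !mxE rmorph_nat. Qed.

Lemma map_self_adjoint (R S : comUnitRingType) (f : {rmorphism R -> S}) n
    (A : 'M[R]_n) : self_adjoint A -> self_adjoint (map_mx f A).
Proof.
rewrite !self_adjoint_mx => /(congr1 (map_mx f)).
by rewrite !map_mxM map_trmx map_antidiag_mx.
Qed.

Lemma horner_mx_commX (R : comNzRingType) n (A : 'M[R]_n.+1) (f : {poly R}) :
  horner_mx A f *m A = A *m horner_mx A f.
Proof. by have := comm_horner_mx f (erefl (A *m A)); rewrite /comm_mx. Qed.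

Lemma horner_mx_eigen (R : comNzRingType) n k (A : 'M[R]_n.+1)
    (x : 'M[R]_(n.+1, k)) a (f : {poly R}) :
  A *m x = a *: x -> horner_mx A f *m x = f.[a] *: x.
Proof.
move=> Ax; elim/poly_ind: f => [|f c IHf].
  by rewrite rmorph0 mul0mx horner0 scale0r.
rewrite rmorphD rmorphM /= horner_mx_X horner_mx_C -mulmxE mulmxDl -mulmxA Ax.
by rewrite -scalemxAr IHf mul_scalar_mx scalerA -scalerDl hornerMXaddC mulrC.
Qed.

Lemma horner_mx_comm_map (R : comNzRingType) n (A B U : 'M[R]_n.+1) (f : {poly R}) :
  A *m U = U *m B -> horner_mx A f *m U = U *m horner_mx B f.
Proof.
move=> AU; elim/poly_ind: f => [|f c IHf].
  by rewrite !rmorph0 mul0mx mulmx0.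
rewrite !rmorphD !rmorphM /= !horner_mx_X !horner_mx_C -!mulmxE mulmxDl mulmxDr.
by rewrite -mulmxA AU !mulmxA IHf scalar_mxC.
Qed.

Lemma horner_mx_self_adjoint (R : comUnitRingType) n (A : 'M[R]_n.+1) (f : {poly R}) :
  self_adjoint A -> self_adjoint (horner_mx A f).
Proof.
rewrite !self_adjoint_mx => AJ; elim/poly_ind: f => [|f c IHf].
  by rewrite rmorph0 trmx0 mul0mx mulmx0.
rewrite !rmorphD !rmorphM /= !horner_mx_X !horner_mx_C -!mulmxE.
rewrite linearD /= trmx_mul tr_scalar_mx mulmxDl mulmxDr scalar_mxC; congr (_ + _).
by rewrite horner_mx_commX -mulmxA IHf mulmxA AJ -mulmxA.
Qed.

Lemma normalize_diag (L : fieldType) n (Q : 'M[L]_n) (t : 'I_n -> L) :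
  (forall i j, i != j -> Q i j = 0) -> (forall k, Q k k != 0) ->
  (forall k, t k ^+ 2 = (Q k k)^-1) ->
  diag_mx (\row_k t k) *m (Q *m diag_mx (\row_k t k)) = 1%:M.
Proof.
move=> Qdiag Q0 tE; apply/matrixP => i j.
rewrite mul_diag_mx mxE mul_mx_diag !mxE.
case: (eqVneq i j) => [<-|ij]; last by rewrite Qdiag // mul0r mulr0.
by rewrite mulrCA -expr2 tE mulfV.
Qed.

Section OrthogonalDiagonalization.

Variables (K : closedFieldType) (n : nat).
Local Notation N := n.+1.
Local Notation J := (@antidiag_mx K N).
Variables (r : 'I_N -> K).
Hypothesis r_inj : injective r.
Local Notation D := (diag_mx (\row_k r k)).

(** Up to a scalar this is the Lagrange polynomial at [r k]: on a matrix with eigenvalues [r] it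
    projects onto the k-th eigenline. Its value at [r k] is the derivative of the characteristic
    polynomial there. *)
Definition other_roots (k : 'I_N) : {poly K} := \prod_(l | l != k) ('X - (r l)%:P).

Lemma other_roots_eq0 k l : l != k -> (other_roots k).[r l] = 0.
Proof.
move=> lk; rewrite horner_prod; apply/eqP; rewrite prodf_seq_eq0.
by apply/hasP; exists l; rewrite ?mem_index_enum // lk hornerXsubC subrr eqxx.
Qed.

Lemma other_roots_neq0 k : (other_roots k).[r k] != 0.
Proof.
rewrite horner_prod; apply/prodf_neq0 => l lk.
by rewrite hornerXsubC subr_eq0 (inj_eq r_inj) eq_sym.
Qed.

Lemma diag_mulE k (x : 'M[K]_(N, k)) i j : (D *m x) i j = r i * x i j.
Proof. by rewrite mul_diag_mx !mxE. Qed.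

(** The Gram matrix of an eigenbasis commutes with [D], whose entries are distinct, so it is
    diagonal; square roots in K then normalize it to the identity. *)
Lemma orthogonal_diagonalization (A : 'M[K]_N) :
  self_adjoint A -> char_poly A = \prod_k ('X - (r k)%:P) ->
  exists2 P : 'M[K]_N, P^T *m J *m P = 1%:M & A *m P = P *m D.
Proof.
rewrite self_adjoint_mx => AJ charA.
have eigvec k : exists u : 'cV[K]_N, A *m u = r k *: u /\ u != 0.
  have /eigenvalueP[v vA v0] : eigenvalue A (r k).
    rewrite eigenvalue_root_char charA rootE horner_prod prodf_seq_eq0.
    by apply/hasP; exists k; rewrite ?mem_index_enum //= hornerXsubC subrr.
  (* [eigenvalueP] provides a row eigenvector; since A J = J A^T, its image under J is a column
     eigenvector. *)
  exists (J *m v^T); split.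
    have JA : A *m J = J *m A^T.
      by rewrite -[J *m _]mulmx1 -(antidiag_sqr K N) !mulmxA -(mulmxA J) AJ !mulmxA
        antidiag_sqr mul1mx.
    by rewrite mulmxA JA -mulmxA -trmx_mul vA linearZ /= -scalemxAr.
  apply: contraNneq v0 => /(congr1 (mulmx J)).
  by rewrite mulmxA antidiag_sqr mul1mx mulmx0 => /(congr1 trmx); rewrite trmxK trmx0 => ->.
have [u uP] := fin_all_exists eigvec.
pose U := \matrix_(i, k) u k i 0.
have colU k : col k U = u k by apply/matrixP => i j; rewrite !mxE ord1.
have AU : A *m U = U *m D.
  apply/matrixP => i k; rewrite mul_mx_diag !mxE.
  have := congr1 (fun M : 'cV_N => M i 0) (uP k).1; rewrite !mxE mulrC => <-.
  by apply: eq_bigr => j _; rewrite !mxE.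
have U_unit : U \in unitmx.
  rewrite -unitmx_tr -row_free_unit; apply: inj_row_free => v.
  move=> /(congr1 trmx); rewrite trmx_mul trmxK trmx0 => Uv.
  apply/matrixP => i k; rewrite ord1 !mxE.
  (* Applying the Lagrange polynomial of [A] to a linear relation among the eigenvectors isolates
     its k-th term. *)
  have /(congr1 (mulmx^~ v^T)) := horner_mx_comm_map (other_roots k) AU.
  rewrite -mulmxA Uv mulmx0 horner_mx_diag => /esym UDv.
  have dv : diag_mx (map_mx (horner (other_roots k)) (\row_k r k)) *m v^T
      = (other_roots k).[r k] *: (v 0 k *: delta_mx k 0).
    apply/matrixP => l j; rewrite mul_diag_mx !mxE ord1 eqxx andbT.
    case: eqP => [->|/eqP lk]; first by rewrite mulr1.
    by rewrite other_roots_eq0 // mul0r !mulr0.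
  move: UDv; rewrite -mulmxA dv -!scalemxAr -colE colU => /eqP.
  rewrite !scaler_eq0 (negPf (other_roots_neq0 k)) (negPf (uP k).2) /= orbF.
  by move/eqP.
pose Q := U^T *m J *m U.
have Q_unit : Q \in unitmx.
  rewrite !unitmx_mul unitmx_tr U_unit andbT /=.
  by case: (mulmx1_unit (antidiag_sqr K N)).
have DQ : D *m Q = Q *m D.
  have -> : D *m Q = (A *m U)^T *m J *m U by rewrite AU trmx_mul tr_diag_mx !mulmxA.
  by rewrite trmx_mul -(mulmxA U^T) AJ -!mulmxA AU !mulmxA.
have Qdiag i j : i != j -> Q i j = 0.
  move=> ij; have := congr1 (fun M : 'M_N => M i j) DQ.
  rewrite diag_mulE mul_mx_diag !mxE mulrC => /eqP; rewrite -subr_eq0 -mulrBr.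
  by rewrite mulf_eq0 subr_eq0 (inj_eq r_inj) (negPf ij) orbF => /eqP.
have Q0 k : Q k k != 0.
  have QE : Q = diag_mx (\row_k Q k k).
    apply/matrixP => i j; rewrite [RHS]mxE [X in X *+ _]mxE.
    by case: (eqVneq i j) => [->|ij]; rewrite ?mulr1n // Qdiag.
  move: Q_unit; rewrite unitmxE QE det_diag unitfE => /prodf_neq0 /(_ k isT).
  by rewrite -QE [X in X != 0 -> _]mxE.
have [t tE] := fin_all_exists (fun k => closed_sqrt (Q k k)^-1).
exists (U *m diag_mx (\row_k t k)); last first.
  rewrite mulmxA AU -!mulmxA; congr (_ *m _).
  by rewrite !mulmx_diag; congr diag_mx; apply/rowP => k; rewrite !mxE mulrC.
rewrite trmx_mul tr_diag_mx -!mulmxA (mulmxA U^T) (mulmxA _ U) -/Q.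
exact: normalize_diag.
Qed.

Lemma interpolation (y : 'I_N -> K) : exists f : {poly K}, forall k, f.[r k] = y k.
Proof.
exists (\sum_k (y k / (other_roots k).[r k]) *: other_roots k) => k.
rewrite horner_sum (bigD1 k) //= big1 => [|l lk].
  by rewrite hornerZ addr0 divfK ?other_roots_neq0.
by rewrite hornerZ (@other_roots_eq0 l k) ?mulr0 // eq_sym.
Qed.

Lemma special_orthogonal_mx (g : 'M[K]_N) :
  special_orthogonal g -> g^T *m J *m g = J /\ g \in unitmx.
Proof.
case=> g_iso g1; split; last by rewrite unitmxE g1 unitr1.
apply: bilinear_mx_ext => x y; have := g_iso x y.
by rewrite !antidiag_formE trmx_mul !mulmxA.
Qed.

(** Orthonormal eigenbases P of A and Q of B, listed in the same order of eigenvalues, give the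
    isometry P Q^(-1) carrying B to A. Its determinant is 1 or -1, so only a sign is left to
    correct. *)
Lemma special_orthogonal_conj (A B : 'M[K]_N) :
  self_adjoint A -> self_adjoint B ->
  char_poly A = \prod_k ('X - (r k)%:P) -> char_poly B = \prod_k ('X - (r k)%:P) ->
  exists2 g : 'M[K]_N, special_orthogonal g & A = g *m B *m invmx g.
Proof.
move=> A_sa B_sa charA charB.
have [P PJ AP] := orthogonal_diagonalization A_sa charA.
have [Q QJ BQ] := orthogonal_diagonalization B_sa charB.
have det2 (X : 'M[K]_N) : X^T *m J *m X = 1%:M -> \det X ^+ 2 * \det J = 1.
  by move/(congr1 determinant); rewrite !det_mulmx det_tr det1 => <-; ring.
have J0 : \det J != 0.
  by apply/eqP => J0; have := det2 _ PJ; rewrite J0 mulr0 => /esym/eqP; rewrite oner_eq0.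
(* Flipping the sign of one eigenvector changes the sign of the determinant. *)
pose e : 'rV[K]_N := \row_k (if k == 0 then -1 else 1).
have [P' [P'J AP' detP']] : exists P', [/\ P'^T *m J *m P' = 1%:M,
    A *m P' = P' *m D & \det P' = \det Q].
  have /eqP : \det P ^+ 2 = \det Q ^+ 2.
    by apply: (mulIf J0); rewrite !det2.
  rewrite eqf_sqr => /orP[/eqP dPQ|/eqP dPQ]; first by exists P.
  exists (P *m diag_mx e); split.
  - rewrite trmx_mul tr_diag_mx -!mulmxA (mulmxA P^T) (mulmxA _ P) PJ mul1mx.
    rewrite mulmx_diag; apply/matrixP => i j; rewrite !mxE.
    case: (eqVneq i j) => [->|//]; rewrite !mulr1n.
    by case: ifP; rewrite ?mulN1r ?opprK ?mulr1.
  - rewrite mulmxA AP -!mulmxA !mulmx_diag; congr (_ *m diag_mx _).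
    by apply/rowP => k; rewrite !mxE mulrC.
  rewrite det_mulmx det_diag (bigD1 0) //= mxE eqxx big1 => [|k k0].
    by rewrite dPQ mulr1 mulrN1 opprK.
  by rewrite mxE (negPf k0).
have Q_unit : Q \in unitmx by case: (mulmx1_unit QJ).
have P_unit : P' \in unitmx by case: (mulmx1_unit P'J).
exists (P' *m invmx Q); last first.
  have g_unit : P' *m invmx Q \in unitmx by rewrite unitmx_mul P_unit unitmx_inv.
  rewrite -[LHS](mulmxK g_unit) mulmxA AP'.
  have -> : D = invmx Q *m B *m Q by rewrite -mulmxA BQ mulKmx.
  by rewrite !mulmxA (mulmxK Q_unit).
split; last by rewrite det_mulmx detP' -det_mulmx mulmxV // det1.
apply: isometry_mx; rewrite trmx_mul -!mulmxA (mulmxA P'^T) (mulmxA _ P') P'J mul1mx.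
by rewrite -[X in _ *m X]mul1mx -QJ !mulmxA mulmxK // -trmx_mul mulmxV // trmx1 mul1mx.
Qed.

(** The isometry g^(-1) h commutes with B, so in an orthonormal eigenbasis it is diagonal with
    entries 1 or -1. Interpolating these signs at the eigenvalues writes it as a polynomial in B,
    the form in which cocycle values are expressed. *)
Lemma cocycle_exists (B g h : 'M[K]_N) :
  self_adjoint B -> char_poly B = \prod_k ('X - (r k)%:P) ->
  g \in unitmx -> g^T *m J *m g = J -> h^T *m J *m h = J ->
  g *m B *m invmx g = h *m B *m invmx h ->
  exists f : {poly K}, (forall k, f.[r k] ^+ 2 = 1) /\ horner_mx B f = invmx g *m h.
Proof.
move=> B_sa charB g_unit gJ hJ ghB.
have [Q QJ BQ] := orthogonal_diagonalization B_sa charB.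
have Q_unit : Q \in unitmx by case: (mulmx1_unit QJ).
have J_unit : J \in unitmx by case: (mulmx1_unit (antidiag_sqr K N)).
have h_unit : h \in unitmx.
  by move: J_unit; rewrite -hJ !unitmx_mul => /andP[].
have [X XE] : exists X, X = invmx g *m h by eexists.
have gX : g *m X = h by rewrite XE mulKVmx.
have XB : B *m X = X *m B.
  rewrite XE; move/(congr1 (fun M => invmx g *m M *m h)): ghB.
  by rewrite !mulmxA mulVmx // mul1mx mulmxKV // => ->.
have XJ : X^T *m J *m X = J.
  have <- : (g *m X)^T *m J *m (g *m X) = X^T *m J *m X.
    by rewrite trmx_mul -[in RHS]gJ !mulmxA.
  by rewrite gX.
have [Y YE] : exists Y, Y = invmx Q *m X *m Q by eexists.
have YD : D *m Y = Y *m D.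
  have -> : D = invmx Q *m B *m Q by rewrite -mulmxA BQ mulKmx.
  by rewrite YE !mulmxA !mulmxK // -(mulmxA _ B) XB !mulmxA.
have YY : Y^T *m Y = 1%:M.
  have QY : Q *m Y = X *m Q by rewrite YE !mulmxA mulmxV // mul1mx.
  have -> : Y^T *m Y = (Q *m Y)^T *m J *m (Q *m Y).
    by rewrite trmx_mul !mulmxA -(mulmxA Y^T Q^T) -(mulmxA Y^T _ Q) QJ mulmx1.
  by rewrite QY trmx_mul !mulmxA -(mulmxA Q^T X^T) -(mulmxA Q^T _ X) XJ.
have Ydiag i j : i != j -> Y i j = 0.
  move=> ij; have := congr1 (fun M : 'M_N => M i j) YD.
  rewrite diag_mulE mul_mx_diag [X in _ = X]mxE [X in _ = _ * X]mxE mulrC => /eqP.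
  rewrite -subr_eq0 -mulrBr.
  by rewrite mulf_eq0 subr_eq0 (inj_eq r_inj) (negPf ij) orbF => /eqP.
have Y2 k : Y k k ^+ 2 = 1.
  have := congr1 (fun M : 'M_N => M k k) YY; rewrite [X in X = _]mxE [X in _ = X]mxE eqxx.
  rewrite (bigD1 k) //= big1 => [|l lk]; last by rewrite Ydiag // mulr0.
  by rewrite addr0 mxE.
have [f fE] := interpolation (fun k => Y k k).
exists f; split=> [k|]; first by rewrite fE.
have -> : invmx g *m h = Q *m Y *m invmx Q.
  by rewrite YE -XE !mulmxA mulmxV // mul1mx mulmxK.
have := horner_mx_comm_map f BQ; rewrite horner_mx_diag => fQ.
rewrite -[LHS](mulmxK Q_unit) fQ; congr (_ *m _ *m _).
apply/matrixP => i j; rewrite mxE mxE [X in horner f X]mxE fE.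
by case: (eqVneq i j) => [->|ij]; [rewrite mulr1n | rewrite mulr0n Ydiag].
Qed.

End OrthogonalDiagonalization.

(** * The Kostant-Weierstrass matrix *)

Section KWSection.

Variables (R : comUnitRingType) (n : nat) (a : 'I_n.+1 -> R).
Local Notation N := n.+1.
Local Notation M := (KW_matrix a).
Local Notation e0 := (delta_mx 0 0 : 'cV[R]_N).

Lemma KW_self_adjoint : self_adjoint M.
Proof.
apply/self_adjoint_mx; rewrite -[LHS]trmxK trmx_mul trmxK antidiag_tr.
apply/matrixP => i j; rewrite mxE !antidiag_mul !mxE /= !rev_ordK !subSS.
have ij : (j - 0 = j)%N by rewrite subn0.
have iN := ltn_ord i; have jN := ltn_ord j.
have E1 k : (k < N)%N -> (n - k == 0)%N = (k.+1 == N)%N by lia.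
rewrite !E1 //; case: (eqVneq i.+1 N) => iE; case: (eqVneq j.+1 N) => jE //.
  by congr a; apply: val_inj => /=; lia.
by congr (_%:R); congr nat_of_bool; lia.
Qed.

(** Outside the last column M e_j = e_(j+1) + a_j e_0, so M^k e_0 is e_k plus basis vectors of
    smaller index, for k < N. *)
Lemma KW_horner (f : {poly R}) (i : 'I_N) :
  (size f <= i.+1)%N -> (horner_mx M f *m e0) i 0 = f`_i.
Proof.
elim/poly_ind: f i => [|f c IHf] i.
  by rewrite rmorph0 mul0mx mxE coef0.
have [->|f0] := eqVneq f 0.
  rewrite mul0r add0r horner_mx_C mul_scalar_mx coefC !mxE eqxx andbT => _.
  by case: eqP => [->|/eqP]; rewrite ?mulr1 // -val_eqE /= => /negPf->; rewrite mulr0.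
rewrite size_MXaddC (negPf f0) ltnS => sf.
have i0 : (0 < i)%N by apply: leq_trans sf; rewrite size_poly_gt0.
rewrite rmorphD rmorphM /= horner_mx_X horner_mx_C.
rewrite -mulmxE horner_mx_commX mulmxDl mul_scalar_mx mxE.
rewrite [X in _ + X]mxE [X in _ + _ * X]mxE eqxx andbT.
have -> : (i == 0) = false by rewrite -val_eqE /=; lia.
rewrite mulr0 addr0 -mulmxA coefD coefMX coefC.
have -> : (i == 0 :> nat) = false by lia.
rewrite addr0 mxE.
have iN := ltn_ord i.
have i'N : (i.-1 < N)%N by lia.
rewrite (bigD1 (Ordinal i'N)) //= big1 => [|j ji].
  rewrite addr0 IHf /= ?prednK // mxE.
  have -> : (val i == 0)%N = false by rewrite (gtn_eqF i0).
  by rewrite /= prednK // (ltn_eqF iN) eqxx mul1r.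
rewrite mxE; have -> : (val i == 0)%N = false by rewrite (gtn_eqF i0).
(* The last column does not follow the subdiagonal pattern, but the degree bound makes the last
   coordinate of f(M) e_0 vanish here. *)
case: eqP => jN.
  have jn : (j : nat) = n by case: jN.
  have sj : (size f <= j)%N by rewrite jn; apply: leq_trans sf _; rewrite -ltnS.
  by rewrite IHf ?leqW // nth_default // mulr0.
rewrite (_ : (val i == j.+1) = false) ?mul0r //; apply/negP => /eqP ij.
by case/negP: ji; rewrite -val_eqE /= ij.
Qed.

Lemma antidiag_form_e0 (y : 'cV[R]_N) : antidiag_form e0 y = y ord_max 0.
Proof.
rewrite /antidiag_form (bigD1 0) //= big1 => [|i i0].
  by rewrite mxE eqxx mul1r addr0; congr (y _ _); apply: val_inj; rewrite /= subn1.
by rewrite mxE (negPf i0) mul0r.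
Qed.

End KWSection.

(** * Section matrices with a prescribed characteristic polynomial *)

Lemma truncated_sqrt (F : fieldType) (F2 : (2%:R : F) != 0) (c : nat -> F) k :
  c 0%N = 1 -> exists2 S : {poly F}, S`_0 = 1 & forall j, (j < k)%N -> (S ^+ 2)`_j = c j.
Proof.
move=> c0; elim: k => [|k [S S0 SE]]; first by exists 1; rewrite ?coef1.
have [->|k0] := posnP k.
  by exists 1; rewrite ?coef1 // => -[|//] _; rewrite expr1n coef1 c0.
(* As S_0 = 1, adding t X^k changes the k-th coefficient of the square by 2t and leaves the lower
   ones alone. This needs k > 0, whence the separate case above. *)
pose t := (c k - (S ^+ 2)`_k) / 2%:R.
exists (S + t *: 'X^k) => [|j].
  by rewrite coefD coefZ coefXn eq_sym (gtn_eqF k0) mulr0 addr0.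
have -> : (S + t *: 'X^k) ^+ 2 = S ^+ 2 + (2%:R * t) *: (S * 'X^k) + t ^+ 2 *: ('X^k * 'X^k).
  rewrite sqrrD exprZn expr2 -scalerAr -scaler_nat scalerA.
  by rewrite [X in _ + _ + _ *: X]expr2.
rewrite !coefD !coefZ coefMXn coefMXn coefXn ltnS leq_eqVlt => /orP[/eqP->|jk].
  rewrite ltnn subnn S0 eq_sym (gtn_eqF k0) mulr0 addr0 mulr1 mulrC divfK //.
  by rewrite addrC subrK.
by rewrite jk !mulr0 !addr0 SE.
Qed.

Section KWExistence.

Variables (F : fieldType) (n : nat).
Local Notation N := n.+1.
Local Notation e0 := (delta_mx 0 0 : 'cV[F]_N).

(* With S the truncated square root of the reversed characteristic polynomial *)
(* and T acting as the KW matrix, the j-th basis vector is                    *)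
(* (T^j + S_1 T^(j-1) + ... + S_j) e0.                                        *)
Lemma KW_char_poly (F2 : (2%:R : F) != 0) (chi : {poly F}) :
  chi \is monic -> size chi = N.+1 ->
  exists a : 'I_N -> F, char_poly (KW_matrix a) = chi.
Proof.
move=> chi_mon chi_size.
have chiN : chi`_N = 1 by move/monicP: chi_mon; rewrite lead_coefE chi_size.
have [|S S0 SE] := @truncated_sqrt F F2 (fun k => chi`_(N - k)) N.
  by rewrite subn0.
pose Q j := \poly_(c < j.+1) S`_(j - c).
have Q_rec j : Q j.+1 = 'X * Q j + (S`_(j.+1))%:P.
  apply/polyP => c; rewrite coefD mulrC coefMX coefC !coef_poly.
  by case: c => [|c] /=; rewrite ?subn0 ?add0r // addr0 ltnS.
(* This is the relation on e_0 read off the last column, up to its constant term. The coefficients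
   of S enter twice, through the first row (inside the [Q i]) and through the last column, so in
   positive degree [Psi] has the coefficients of S^2: hence the square root. *)
pose Psi := 'X * Q n + \sum_(1 <= i < N) S`_(N - i) *: Q i.
have PsiE c : (0 < c)%N -> Psi`_c = chi`_c.
  move=> c0; rewrite coefD mulrC coefMX (gtn_eqF c0) coef_sum coef_poly prednK //.
  have [cN|Nc] := leqP c N; last first.
    rewrite [RHS]nth_default ?chi_size // add0r.
    rewrite big_nat big1 // => i iN.
    by rewrite coefZ coef_poly ltnNge (_ : (i < c)%N) ?mulr0 //; lia.
  have [->|cN'] := eqVneq c N.
    rewrite subnn S0 big_nat big1 ?addr0 ?chiN // => i /andP[_ iN].
    by rewrite coefZ coef_poly ltnNge iN mulr0.
  have ltNc : (N - c < N)%N by lia.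
  have := SE _ ltNc; rewrite subKn // => <-.
  rewrite expr2 coefM big_ord_recr /= subnn S0 mulr1 [LHS]addrC.
  rewrite (@big_cat_nat _ _ _ c) //= [X in X + _ + _]big_nat.
  rewrite big1 ?add0r => [|i ic]; last first.
    by rewrite coefZ coef_poly ltnS leqNgt (andP ic).2 mulr0.
  rewrite -{1}(add0n c) big_addn big_mkord; congr (_ + _); last by congr (S`_ _); lia.
  apply: eq_bigr => i _; rewrite coefZ coef_poly.
  have -> : (c < (i + c).+1)%N by lia.
  by rewrite addnK mulrC; congr (_ * S`_ _); lia.
(* The last parameter sits in the corner common to the first row and the last column; it affects
   only the constant term and is used to correct it. *)
pose a (j : 'I_N) := if j.+1 == N then Psi`_0 - chi`_0 else - S`_(j.+1).
exists a; set M := KW_matrix a.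
have Q_e0 j (jN : (j < N)%N) : horner_mx M (Q j) *m e0 = delta_mx (Ordinal jN) 0.
  elim: j jN => [|j IHj] jN.
    have -> : Q 0%N = 1.
      by apply/polyP => -[|c]; rewrite coef_poly coef1 /= ?S0.
    by rewrite rmorph1 mul1mx; congr delta_mx; apply: val_inj.
  have jN' : (j < N)%N by apply: ltnW.
  rewrite Q_rec rmorphD rmorphM /= horner_mx_X horner_mx_C mulmxDl mul_scalar_mx.
  rewrite -mulmxA IHj -colE; apply/matrixP => i k; rewrite ord1 !mxE /= !andbT.
  have -> : (j.+1 == N) = false by lia.
  rewrite -!val_eqE /=; case: eqP => [->|i0].
    by rewrite /a /= (_ : (j.+1 == N) = false) ?mulr1 ?addNr //; lia.
  by rewrite mulr0 addr0.
pose Phi := Psi - (Psi`_0 - chi`_0)%:P.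
have PhiE : Phi = chi.
  apply/polyP => -[|c]; rewrite coefB coefC /=; first by rewrite opprB addrC subrK.
  by rewrite subr0 PsiE.
have Phi_e0 : horner_mx M Phi *m e0 = 0.
  rewrite rmorphB rmorphD rmorphM rmorph_sum /= horner_mx_X horner_mx_C.
  rewrite !mulmxDl -mulmxA (Q_e0 n (ltnSn n)) -colE mulNmx mul_scalar_mx.
  rewrite mulmx_suml; apply/matrixP => i k; rewrite ord1 !mxE summxE {k}.
  have -> : \sum_(1 <= l < N) (horner_mx M (S`_(N - l) *: Q l) *m e0) i 0
      = \sum_(1 <= l < N) S`_(N - l) * (i == l :> nat)%:R.
    apply: eq_big_nat => l /andP[_ lN].
    by rewrite linearZ /= -scalemxAl (Q_e0 l lN) !mxE andbT.
  rewrite /= eqxx !andbT; case: eqP => [i0|/eqP i0].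
    rewrite /a /= eqxx -val_eqE /= i0 eqxx mulr1 big_nat big1 ?addr0 ?subrr // => l l0.
    by rewrite (ltn_eqF (andP l0).1) mulr0.
  rewrite /a /= subSS -val_eqE /= (negPf i0) mulr0 subr0.
  have iN := ltn_ord i.
  have -> : ((n - i).+1 == N) = false by apply/eqP; move/eqP: i0; lia.
  rewrite (@big_cat_nat _ _ _ i) //=; [|by rewrite lt0n|exact: ltnW].
  rewrite big_nat big1 ?add0r => [|l /andP[_ li]]; last by rewrite (gtn_eqF li) mulr0.
  rewrite big_ltn // eqxx mulr1 big_nat big1 => [|l /andP[il _]]; last first.
    by rewrite (ltn_eqF il) mulr0.
  by rewrite addr0 -subSn ?addNr.
rewrite PhiE in Phi_e0.
(* Both polynomials are monic of degree N and kill e_0, so their difference has degree less than N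
   and kills e_0 too; [KW_horner] then reads its leading coefficient as 0. *)
pose rho := chi - char_poly M.
have rho_size : (size rho <= N)%N.
  apply/leq_sizeP => k; rewrite leq_eqVlt coefB => /orP[/eqP<-|Nk].
    have := char_poly_monic M; rewrite monicE lead_coefE size_char_poly => /eqP ->.
    by rewrite chiN subrr.
  by rewrite !nth_default ?subrr ?chi_size ?size_char_poly.
have rho_e0 : horner_mx M rho *m e0 = 0.
  by rewrite rmorphB /= Cayley_Hamilton subr0.
apply/eqP; rewrite eq_sym -subr_eq0 -/rho -lead_coef_eq0 lead_coefE.
have [->|rho0] := eqVneq rho 0; first by rewrite coef0.
have rN : ((size rho).-1 < N)%N by apply: leq_trans rho_size; rewrite prednK // size_poly_gt0.
have := @KW_horner _ _ a rho (Ordinal rN); rewrite rho_e0 mxE /= => <- //.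
by rewrite prednK // size_poly_gt0.
Qed.

End KWExistence.

(** * The class of the cocycle *)

Section Trace.

Variables (F : finFieldType) (K : closedFieldType) (iota : {rmorphism F -> K}).
Variable p : {poly F}.
Hypothesis p_irr : monic_irreducible_poly p.
Local Notation d := (size p).-1.

(** Evaluating X^i x at a conjugate w of z in two ways shows that the Vandermonde matrix of the
    conjugates diagonalizes multiplication by x, with eigenvalues x(w). *)
Lemma qpoly_trace_roots z (x : {poly %/ p}) : root (map_poly iota p) z ->
  iota (qpoly_trace x) = \sum_(w <- conj_roots p z) qpoly_eval iota w x.
Proof.
move=> pz; rewrite /qpoly_trace -trace_map_mx -mxtrace_tr.
set T := _^T.
rewrite /conj_roots big_map big_mkord.
set w := fun s : 'I_d => z ^+ (#|F| ^ s).
pose V := Vandermonde d (\row_(s < d) w s).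
have pw s : root (map_poly iota p) (w s) by apply: frob_root.
have p_mon := irr_monic p_irr; have p_gt1 := irr_size p_irr.
have TV : T *m V = V *m diag_mx (\row_s qpoly_eval iota (w s) x).
  rewrite mul_mx_diag; apply/matrixP => i s; rewrite !mxE.
  rewrite -[w s ^+ i]hornerXn -(map_polyXn iota) -(qpoly_eval_in p_mon p_gt1 (pw s)).
  rewrite -qpoly_evalM // /qpoly_eval (@horner_coef_wide _ d).
    by apply: eq_bigr => j _; rewrite !mxE coef_map.
  by rewrite size_map_poly -ltnS prednK ?size_qpoly // ltnW.
have w_inj : injective w.
  move=> s t wst; have := conj_roots_uniq p_irr pz; rewrite /conj_roots.
  move/(nth_uniq 0)=> /(_ s t).
  rewrite size_map size_iota subn0 !ltn_ord !(nth_map 0%N) ?size_iota ?subn0 ?ltn_ord //.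
  rewrite !nth_iota ?subn0 ?ltn_ord // !add0n -/(w s) -/(w t) wst eqxx.
  by move=> /(_ isT isT) /esym /eqP /val_inj.
have V_unit : V \in unitmx.
  rewrite unitmxE unitfE det_Vandermonde; apply/prodf_neq0 => s _.
  apply/prodf_neq0 => t st; rewrite !mxE subr_eq0 (inj_eq w_inj).
  by rewrite -val_eqE /= (gtn_eqF st).
rewrite -[T](mulmxK V_unit) TV mxtrace_mulC mulKmx // mxtrace_diag.
by apply: eq_bigr => s _; rewrite mxE.
Qed.

End Trace.

Lemma map_KW_matrix (R S : comUnitRingType) (f : {rmorphism R -> S}) n (a : 'I_n -> R) :
  map_mx f (KW_matrix a) = KW_matrix (f \o a).
Proof.
apply/matrixP => i j; rewrite !mxE; case: ifP => // _; case: ifP => // _.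
by rewrite rmorph_nat.
Qed.

Lemma antidiag_form_map (R S : comUnitRingType) (f : {rmorphism R -> S}) n (x y : 'cV[R]_n) :
  antidiag_form (map_mx f x) (map_mx f y) = f (antidiag_form x y).
Proof. by rewrite rmorph_sum; apply: eq_bigr => i _; rewrite !mxE rmorphM. Qed.

Lemma antidiag_formZr (R : comUnitRingType) n c (x y : 'cV[R]_n) :
  antidiag_form x (c *: y) = c * antidiag_form x y.
Proof. by rewrite !antidiag_formE -scalemxAr mxE. Qed.

Lemma antidiag_form_sumr (R : comUnitRingType) n (I : finType) (x : 'cV[R]_n)
    (y : I -> 'cV[R]_n) :
  antidiag_form x (\sum_k y k) = \sum_k antidiag_form x (y k).
Proof.
rewrite antidiag_formE mulmx_sumr summxE; apply: eq_bigr => k _.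
by rewrite antidiag_formE.
Qed.

Lemma horner_mx_coef (R : comNzRingType) n (A : 'M[R]_n.+1) (f : {poly R}) :
  horner_mx A f = \sum_(k < size f) f`_k *: horner_mx A 'X^k.
Proof.
rewrite -{1}[f]coefK poly_def rmorph_sum; apply: eq_bigr => k _.
by rewrite -mul_polyC rmorphM /= horner_mx_C -mulmxE mul_scalar_mx.
Qed.

Section RelativeKummer.

Variables (F : finFieldType) (K : closedFieldType) (iota : {rmorphism F -> K}).
Variables (n : nat) (lam : 'M[F]_n.+1).
Hypothesis lam_sa : self_adjoint lam.
Variables (m : nat) (p : 'I_m -> {poly F}).
Hypothesis p_irr : forall i, monic_irreducible_poly (p i).
Hypothesis p_prod : char_poly lam = \prod_i p i.
Variables (eta : forall i, {unit {poly %/ p i}})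
          (phi : forall i, {poly %/ p i} -> 'cV[F]_n.+1).
Hypothesis lam_eta : form_decomposition lam eta phi.
Variable r : 'I_n.+1 -> K.
Hypothesis r_inj : injective r.
Local Notation A := (map_mx iota lam).
Local Notation pK i := (map_poly iota (p i)).
Hypothesis char_r : char_poly A = \prod_k ('X - (r k)%:P).

Let form_phi i (x y : {poly %/ p i}) :
  antidiag_form (phi x) (phi y) = qpoly_trace (val (eta i) * x * y).
Proof.
have [phi_lin _ _ form] := lam_eta.
(* [lam_eta] speaks of families over all indices; extension by zero isolates the i-th summand. *)
pose ext (z : {poly %/ p i}) := dfwith (fun j => 0 : {poly %/ p j}) z.
have phi0 j : phi (0 : {poly %/ p j}) = 0.
  have := (phi_lin j).1 (-1) 0 0.
  by rewrite scaler0 addr0 scaleN1r addNr.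
have sum_phi z : \sum_j phi (ext z j) = phi z.
  rewrite (bigD1 i) //= {1}/ext dfwith_in big1 ?addr0 // => j ji.
  by rewrite /ext dfwith_out ?phi0 // eq_sym.
rewrite -(sum_phi x) -(sum_phi y) form (bigD1 i) //= /ext !dfwith_in.
rewrite [X in _ + X]big1 ?addr0 // => j ji.
rewrite !dfwith_out 1?eq_sym // mulr0 /qpoly_trace /mxtrace big1 // => k _.
by rewrite mxE mulr0 coef0.
Qed.

Let x0 i := phi (1 : {poly %/ p i}).

Let horner_x0 i (f : {poly F}) : horner_mx lam f *m x0 i = phi (in_qpoly (p i) f).
Proof.
have [phi_lin phiX _ _] := lam_eta.
elim/poly_ind: f => [|f c IHf].
  rewrite rmorph0 mul0mx in_qpoly0; have := (phi_lin i).1 (-1) 0 0.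
  by rewrite scaler0 addr0 scaleN1r addNr.
rewrite rmorphD rmorphM /= horner_mx_X horner_mx_C.
rewrite -mulmxE horner_mx_commX mulmxDl mul_scalar_mx -mulmxA IHf -phiX addrC -(phi_lin i).1.
congr phi; rewrite in_qpolyD in_qpolyM mulrC addrC; congr (_ + _).
by rewrite -alg_polyC in_qpolyZ in_qpoly1.
Qed.

Let x0K i := map_mx iota (x0 i).

(** The trace form is given over F only; expanding f in monomials extends it to coefficients in
    K. *)
Let form_x0 i w (f : {poly K}) : root (pK i) w ->
  antidiag_form (x0K i) (horner_mx A f *m x0K i)
  = \sum_(z <- conj_roots (p i) w) qpoly_eval iota z (val (eta i)) * f.[z].
Proof.
move=> pw; have p_mon := irr_monic (p_irr i); have p_gt1 := irr_size (p_irr i).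
rewrite horner_mx_coef mulmx_suml antidiag_form_sumr.
under [RHS]eq_bigr do rewrite horner_coef mulr_sumr.
rewrite [RHS]exchange_big; apply: eq_bigr => k _ /=.
rewrite -scalemxAl antidiag_formZr.
have -> : horner_mx A 'X^k *m x0K i = map_mx iota (horner_mx lam 'X^k *m x0 i).
  by rewrite map_mxM map_horner_mx map_polyXn.
rewrite antidiag_form_map horner_x0 form_phi mulr1 (qpoly_trace_roots (p_irr i) _ pw).
rewrite mulr_sumr big_seq [RHS]big_seq; apply: eq_bigr => z zw.
have pz : root (pK i) z by rewrite -(mem_conj_roots (p_irr i) _ pw).
by rewrite qpoly_evalM // qpoly_eval_in // map_polyXn hornerXn; ring.
Qed.

(* This choice of eigenvector is equivariant: s(u_w) = u_(s w). *)
Let u i w : 'cV[K]_n.+1 := horner_mx A (pK i %/ ('X - w%:P)) *m x0K i.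

Let pK_div i w : root (pK i) w -> pK i = (pK i %/ ('X - w%:P)) * ('X - w%:P).
Proof. by rewrite -dvdp_XsubCl => /divpK. Qed.

Let div_root i w : root (pK i) w ->
  (pK i %/ ('X - w%:P)).[w] = (map_poly iota (p i)^`()).[w].
Proof.
move=> pw; rewrite -deriv_map {2}(pK_div pw) derivM derivXsubC mulr1.
by rewrite hornerD hornerM hornerXsubC subrr mulr0 add0r.
Qed.

Let u_eigen i w : root (pK i) w -> A *m u i w = w *: u i w.
Proof.
move=> pw; apply/eqP; rewrite -subr_eq0; apply/eqP.
have -> : A *m u i w - w *: u i w = horner_mx A (pK i) *m x0K i.
  rewrite {1}(pK_div pw) mulrC rmorphM rmorphB /= horner_mx_X horner_mx_C.
  by rewrite -mulmxE -mulmxA mulmxBl mul_scalar_mx.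
rewrite -map_horner_mx -map_mxM; have [_ _ phi_ker _] := lam_eta.
by have [_ ->] := phi_ker i (x0 i); rewrite ?map_mx0 //; exists 1.
Qed.

Let A_sa : self_adjoint A := map_self_adjoint iota lam_sa.

(** By self-adjointness one factor p_i/(T - w) moves to the other side, where it acts on u_w by the
    scalar p_i'(w). The second factor kills every term of the trace sum except z = w. *)
Let u_norm i w : root (pK i) w ->
  antidiag_form (u i w) (u i w)
  = qpoly_eval iota w (val (eta i)) * (map_poly iota (p i)^`()).[w] ^+ 2.
Proof.
move=> pw; rewrite {1}/u (horner_mx_self_adjoint _ A_sa).
rewrite (horner_mx_eigen _ (u_eigen pw)) antidiag_formZr (form_x0 _ pw).
have w_in : w \in conj_roots (p i) w by rewrite (mem_conj_roots (p_irr i) _ pw).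
rewrite (bigD1_seq w w_in (conj_roots_uniq (p_irr i) pw)) /=.
rewrite big_seq_cond big1 => [|z /andP[]]; last first.
  rewrite (mem_conj_roots (p_irr i) _ pw) => pz zw.
  have : (pK i).[z] == 0 by rewrite -rootE.
  rewrite {1}(pK_div pw) hornerM mulf_eq0 hornerXsubC subr_eq0 (negPf zw) orbF.
  by move/eqP->; rewrite mulr0.
by rewrite addr0 !div_root //; ring.
Qed.

Let char_pK : char_poly A = \prod_i pK i.
Proof. by rewrite -map_char_poly p_prod rmorph_prod. Qed.

Let root_r i w : root (pK i) w -> exists k, w = r k.
Proof.
move=> pw; have : root (char_poly A) w.
  by rewrite char_pK (bigD1 i) //= rootM pw.
rewrite char_r rootE horner_prod prodf_seq_eq0 => /hasP[k _ /=].
by rewrite hornerXsubC subr_eq0 => /eqP ->; exists k.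
Qed.

Let other_rootsE i k : root (pK i) (r k) ->
  (other_roots r k).[r k]
  = (map_poly iota (p i)^`()).[r k] * \prod_(j | j != i) (pK j).[r k].
Proof.
move=> pk; rewrite -div_root // -horner_prod -hornerM; congr (_.[_]).
have XC0 : 'X - (r k)%:P != 0 by rewrite polyXsubC_eq0.
apply: (mulfI XC0).
have <- : char_poly A = ('X - (r k)%:P) * other_roots r k by rewrite char_r (bigD1 k).
by rewrite char_pK (bigD1 i) //= {1}(pK_div pk); ring.
Qed.

Lemma coprime_roots i j w : root (pK i) w -> j != i -> ~~ root (pK j) w.
Proof.
move=> pw ji; have [k wk] := root_r pw; rewrite wk in pw *.
have := other_roots_neq0 r_inj k; rewrite (other_rootsE pw) mulf_eq0 negb_or.
by case/andP=> _ /prodf_neq0 /(_ j ji).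
Qed.

Lemma deriv_neq0 i w : root (pK i) w -> (map_poly iota (p i)^`()).[w] != 0.
Proof.
move=> pw; have [k wk] := root_r pw; rewrite wk in pw *.
have := other_roots_neq0 r_inj k; rewrite (other_rootsE pw) mulf_eq0 negb_or.
by case/andP.
Qed.

(** In an orthonormal eigenbasis u_w has a single nonzero coordinate k. Testing the hypothesis on
    [other_roots r k] isolates the same coordinate of v, whose square is therefore the inverse of
    p_lam'(w). *)
Let u_coord (v : 'cV[K]_n.+1) :
  (forall f : {poly K}, f \is monic -> size f = n.+1 ->
     antidiag_form v (horner_mx A f *m v) = 1) ->
  forall i w, root (pK i) w ->
  antidiag_form (u i w) v ^+ 2 * \prod_(j | j != i) (pK j).[w]
  = qpoly_eval iota w (val (eta i)) * (map_poly iota (p i)^`()).[w].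
Proof.
move=> v_form i w pw; have [P PJ AP] := orthogonal_diagonalization r_inj A_sa char_r.
have [k wk] := root_r pw.
have P_unit : P \in unitmx by case: (mulmx1_unit PJ).
pose z := invmx P *m v; pose y := invmx P *m u i w.
have formP (x x' : 'cV[K]_n.+1) : antidiag_form (P *m x) (P *m x') = \sum_l x l 0 * x' l 0.
  rewrite antidiag_formE trmx_mul !mulmxA -(mulmxA x^T) -(mulmxA x^T) PJ mulmx1 mxE.
  by apply: eq_bigr => l _; rewrite mxE.
have vE : v = P *m z by rewrite /z mulKVmx.
have uE : u i w = P *m y by rewrite /y mulKVmx.
have y0 l : l != k -> y l 0 = 0.
  move=> lk; have : diag_mx (\row_k r k) *m y = w *: y.
    apply: (can_inj (mulKmx P_unit)); rewrite -scalemxAr -uE -u_eigen // uE.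
    by rewrite !mulmxA AP.
  move/matrixP/(_ l 0); rewrite diag_mulE [RHS]mxE wk => /eqP.
  by rewrite -subr_eq0 -mulrBl mulf_eq0 subr_eq0 (inj_eq r_inj) (negPf lk) => /eqP.
have o_mon : other_roots r k \is monic by apply: monic_prod_XsubC.
have size_o : size (other_roots r k) = n.+1.
  have := size_char_poly A; rewrite char_r (bigD1 k) //= -/(other_roots r k).
  by rewrite size_mul ?polyXsubC_eq0 ?monic_neq0 // size_XsubC => -[].
have uv : antidiag_form (u i w) v = y k 0 * z k 0.
  rewrite uE vE formP (bigD1 k) //= big1 ?addr0 // => l lk.
  by rewrite y0 // mul0r.
have uu : antidiag_form (u i w) (u i w) = y k 0 ^+ 2.
  rewrite uE formP (bigD1 k) //= big1 ?addr0 // => l lk.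
  by rewrite y0 // mul0r.
have diagE (x : 'cV[K]_n.+1) l :
    (diag_mx (map_mx (horner (other_roots r k)) (\row_k r k)) *m x) l 0
    = (other_roots r k).[r l] * x l 0.
  by rewrite mul_diag_mx !mxE.
have := v_form _ o_mon size_o.
rewrite {2}vE mulmxA (horner_mx_comm_map _ AP) -mulmxA {1}vE formP horner_mx_diag.
rewrite (bigD1 k) //= big1 => [|l lk]; last by rewrite diagE other_roots_eq0 // mul0r mulr0.
rewrite addr0 diagE.
move: (u_norm pw) (deriv_neq0 pw); rewrite uu uv wk in pw *.
rewrite (other_rootsE pw) => yE d0 zE; apply: (mulIf d0).
set Pi := \prod_(j | _) _ in zE *.
rewrite -[RHS]mulrA -expr2 -yE -[RHS]mulr1 -zE; ring.
Qed.

Section Data.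

Variables (a : 'I_n.+1 -> F) (g : 'M[K]_n.+1).
Variable c : {rmorphism K -> K} -> {poly %/ (map_poly iota (char_poly lam))}.
Hypothesis a_char : char_poly (KW_matrix a) = char_poly lam.
Hypothesis g_so : special_orthogonal g.
Hypothesis g_conj : A = g *m map_mx iota (KW_matrix a) *m invmx g.
Hypothesis g_c : is_cocycle_of (KW_matrix a) g c.
Local Notation M := (map_mx iota (KW_matrix a)).

Let v : 'cV[K]_n.+1 := g *m delta_mx 0 0.

Let Ag : A *m g = g *m M.
Proof. by rewrite g_conj mulmxKV // (special_orthogonal_mx g_so).2. Qed.

Let v_form (f : {poly K}) : f \is monic -> size f = n.+1 ->
  antidiag_form v (horner_mx A f *m v) = 1.
Proof.
move=> f_mon f_size.
rewrite {2}/v mulmxA (horner_mx_comm_map _ Ag) -mulmxA g_so.1 antidiag_form_e0.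
rewrite map_KW_matrix KW_horner ?f_size //.
by move/monicP: f_mon; rewrite lead_coefE f_size.
Qed.

(* The KW form is the trace form with coefficient 1 / p_lam', so the class is *)
(* that of eta p_lam', here modified by the square of prod_(j != i) p_j.      *)
Definition kummer_rep i : {poly %/ p i} :=
  val (eta i) * in_qpoly (p i) (p i)^`()
  * (in_qpoly (p i) (\prod_(j | j != i) p j))^-1.

Let prod_neq0 i : in_qpoly (p i) (\prod_(j | j != i) p j) != 0.
Proof.
have [w pw] := irr_has_root iota (p_irr i).
rewrite -(irr_eval_eq0 (p_irr i) _ pw) qpoly_eval_in ?irr_monic ?irr_size //.
rewrite rmorph_prod horner_prod; apply/prodf_neq0 => j ji.
by have := coprime_roots pw ji; rewrite rootE.
Qed.

Lemma kummer_repE i w : root (pK i) w ->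
  qpoly_eval iota w (kummer_rep i) * \prod_(j | j != i) (pK j).[w]
  = qpoly_eval iota w (val (eta i)) * (map_poly iota (p i)^`()).[w].
Proof.
move=> pw; have p_mon := irr_monic (p_irr i); have p_gt1 := irr_size (p_irr i).
have -> : \prod_(j | j != i) (pK j).[w]
    = qpoly_eval iota w (in_qpoly (p i) (\prod_(j | j != i) p j)).
  by rewrite qpoly_eval_in // rmorph_prod horner_prod.
rewrite -qpoly_evalM // /kummer_rep divrK ?(irr_unit (p_irr i)) ?prod_neq0 //.
by rewrite qpoly_evalM // qpoly_eval_in.
Qed.

Lemma kummer_rep_unit i : kummer_rep i \is a GRing.unit.
Proof.
rewrite !unitrM unitrV !(irr_unit (p_irr i)) prod_neq0 andbT.
rewrite -(irr_unit (p_irr i)) (valP (eta i)) /=.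
have [w pw] := irr_has_root iota (p_irr i).
rewrite -(irr_eval_eq0 (p_irr i) _ pw) qpoly_eval_in ?irr_monic ?irr_size //.
exact: deriv_neq0.
Qed.

Lemma cocycle_kummer_class i :
  kummer_class (fun s => in_qpoly (pK i) (c s : {poly K}))
    (FinRing.unit {poly %/ p i} (kummer_rep_unit i)).
Proof.
have p_mon := irr_monic (p_irr i); have p_gt1 := irr_size (p_irr i).
have pK_mon := map_irr_monic iota (p_irr i); have pK_gt1 := map_irr_size iota (p_irr i).
have [f fE] := interpolation r_inj (fun k => antidiag_form (u i (r k)) v).
pose b := in_qpoly (pK i) f.
have bE w : root (pK i) w -> (b : {poly K}).[w] = antidiag_form (u i w) v.
  by move=> pw; rewrite horner_in_qpoly //; have [k ->] := root_r pw.
have b2 : b ^+ 2 = in_qpoly (pK i) (map_poly iota (kummer_rep i)).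
  apply: (irr_qpoly_inj (p_irr i)) => w pw.
  rewrite horner_qpolyX // bE // horner_in_qpoly //.
  have P0 : \prod_(j | j != i) (pK j).[w] != 0.
    by apply/prodf_neq0 => j ji; have := coprime_roots pw ji; rewrite rootE.
  by apply: (mulIf P0); rewrite u_coord // -kummer_repE.
(* No coboundary is left over: with b(w) = <u_w, v>, the component of the cocycle is exactly b^(-1)
   s(b). *)
exists b => //; exists 1; first by rewrite expr1n.
move=> s s_gal.
have [[si sK siK] s_iota] := s_gal.
have s_map (f' : {poly F}) : map_poly s (map_poly iota f') = map_poly iota f'.
  by rewrite -map_poly_comp; apply: eq_map_poly => x /=.
have s_mx k l (X : 'M[F]_(k, l)) : map_mx s (map_mx iota X) = map_mx iota X.
  by rewrite -map_mx_comp; apply/matrixP => i' j'; rewrite !mxE /=.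
have su w : map_mx s (u i w) = u i (s w).
  rewrite map_mxM map_horner_mx /= !s_mx map_divp s_map.
  by rewrite rmorphB /= map_polyX map_polyC.
have g_unit : g \in unitmx := (special_orthogonal_mx g_so).2.
(* s(v) = s(g) e_0 = g c_s(M) e_0 = c_s(A) v, since g intertwines M and A. *)
have sv : map_mx s v = horner_mx A (c s) *m v.
  rewrite map_mxM map_delta_mx mulmxA (horner_mx_comm_map _ Ag).
  by rewrite (g_c s_gal).2 mulKVmx.
have b_unit : b \is a GRing.unit.
  rewrite -(unitrX_pos _ (isT : 0 < 2)%N) b2.
  by rewrite map_qpoly_unit ?kummer_rep_unit.
have act1 : galois_act s (1 : {poly %/ pK i}) = 1.
  by rewrite /galois_act qpolyCE rmorph1 in_qpoly1.
rewrite act1 invr1 !mulr1.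
suff -> : galois_act s b = b * in_qpoly (pK i) (c s : {poly K}) by rewrite mulKr.
(* Every root is written as s(w), where s(b) takes the value s(b(w)) = <u_(s w), c_s(A) v>. Moving
   c_s(A) onto the eigenvector u_(s w) produces the factor c_s(s w). *)
apply: (irr_qpoly_inj (p_irr i)) => w' pw'; rewrite -(siK w') in pw' *.
have pw : root (pK i) (si w').
  by rewrite -(fmorph_root s) s_map.
rewrite /galois_act horner_in_qpoly // horner_map bE // -antidiag_form_map su sv.
rewrite horner_qpolyM // bE // horner_in_qpoly //.
rewrite -(horner_mx_self_adjoint _ A_sa) (horner_mx_eigen _ (u_eigen pw')).
by rewrite antidiag_formC antidiag_formZr antidiag_formC mulrC.
Qed.

End Data.
End RelativeKummer.

(** * Characters of the component group *)

Section ComponentCharacters.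

Variables (F : finFieldType) (m : nat) (p : 'I_m -> {poly F}).
Hypothesis p_irr : forall i, monic_irreducible_poly (p i).
Hypothesis F2 : (2%:R : F) != 0.
Local Notation G := (comp_group p).
Local Notation gen := (comp_gen p).

Lemma irr_N1_neq1 i : -1 != 1 :> {poly %/ p i}.
Proof.
rewrite eq_sym -subr_eq0 opprK -mulr2n; apply: contraNneq F2.
move=> two0; have := qpolyC_natr (p i) 2; rewrite two0 => /esym.
by rewrite -polyC_natr => /eqP; rewrite polyC_eq0.
Qed.

Lemma mu2_cases i (u : {unit {poly %/ p i}}) :
  u \in mu2 {poly %/ p i} -> u = 1%g \/ u = FinRing.unit {poly %/ p i} (unitrN1 _).
Proof.
rewrite inE => /eqP u2; have : (val u : {poly %/ p i with p_irr i}) ^+ 2 == 1.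
  by apply/eqP; have := congr1 val u2.
by rewrite sqrf_eq1 => /orP[]/eqP uE; [left|right]; apply: val_inj.
Qed.

Lemma comp_gen_mem i : gen i \in G.
Proof.
apply/setXnP => j; rewrite /comp_gen.
have [<-|ij] := eqVneq i j; last by rewrite dfung1_dflt // group1.
rewrite dfung1_id inE; apply/eqP; apply: val_inj => /=.
by rewrite mulrNN mulr1.
Qed.

Lemma comp_group_prod x : x \in G -> x = (\prod_(i | x i != 1) gen i)%g.
Proof.
move=> /setXnP xG; apply/ffunP => j; rewrite prodg_ffun.
have [xj|xj] := eqVneq (x j) 1%g.
  rewrite xj big1 // => i xi; rewrite dfung1_dflt //.
  by apply: contraNneq xi => ->; rewrite xj.
rewrite (big_only1 j) // => [|i ij _]; last by rewrite dfung1_dflt.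
rewrite dfung1_id; case: (mu2_cases (xG j)) => // xE.
by rewrite xE eqxx in xj.
Qed.

Lemma comp_char_inj (chi chi' : 'CF(G)) :
  chi \is a linear_char -> chi' \is a linear_char ->
  (forall i, chi (gen i) = chi' (gen i)) -> chi = chi'.
Proof.
move=> lin lin' eq_gen; apply/cfun_inP => x xG.
rewrite (comp_group_prod xG) !lin_char_prod //; try by move=> *; apply: comp_gen_mem.
by apply: eq_bigr.
Qed.

(** A coordinate of an element of the group is 1 or -1, so multiplicativity reduces to v_i^2 = 1.
    Passing through a representation of degree one supplies the class function. *)
Lemma comp_char_exists (v : 'I_m -> algC) : (forall i, v i ^+ 2 = 1) ->
  exists2 chi : 'CF(G), chi \is a linear_char & forall i, chi (gen i) = v i.
Proof.
move=> v2; pose f (x : {dffun forall i, {unit {poly %/ p i}}}) : algC :=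
  \prod_i (if x i == 1%g then 1 else v i).
have fM : {in G &, {morph f : x y / (x * y)%g >-> x * y}}.
  move=> x y /setXnP xG /setXnP yG; rewrite /f -big_split; apply: eq_bigr => i _ /=.
  rewrite mulg_ffun.
  case: (mu2_cases (xG i)) => ->; first by rewrite mul1g eqxx mul1r.
  case: (mu2_cases (yG i)) => ->; first by rewrite mulg1 eqxx mulr1.
  have -> : (FinRing.unit {poly %/ p i} (unitrN1 _)
      * FinRing.unit {poly %/ p i} (unitrN1 _) = 1)%g.
    by apply: val_inj; rewrite /= mulrNN mulr1.
  by rewrite eqxx -val_eqE /= (negPf (irr_N1_neq1 i)) -expr2 v2.
have f1 : f 1%g = 1 by rewrite /f big1 // => i _; rewrite oneg_ffun eqxx.
have f_repr : mx_repr G (fun x => (f x)%:M : 'M_1).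
  split=> [|x y xG yG]; first by rewrite f1.
  by rewrite fM // scalar_mxM.
pose rG := MxRepresentation f_repr.
exists (cfRepr rG); first by rewrite qualifE /= cfRepr_char cfRepr1 eqxx.
move=> i; rewrite cfunE comp_gen_mem /= mxtrace_scalar mulr1n /f.
rewrite (bigD1 i) //= big1 => [|j ji]; last by rewrite dfung1_dflt 1?eq_sym // eqxx.
by rewrite dfung1_id -val_eqE /= (negPf (irr_N1_neq1 i)) mulr1.
Qed.

End ComponentCharacters.

(** * Existence of the class and independence of the choices *)

Lemma cocycle_component_sqr (R : finFieldType) (K : closedFieldType)
    (iota : {rmorphism R -> K}) (chi p : {poly R})
    (c : {poly %/ (map_poly iota chi)}) :
  chi \is monic -> (1 < size chi)%N -> monic_irreducible_poly p -> p %| chi ->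
  c ^+ 2 = 1 -> in_qpoly (map_poly iota p) (c : {poly K}) ^+ 2 = 1.
Proof.
move=> chi_mon chi_gt1 p_irr p_chi c2.
have pM := map_irr_monic iota p_irr; have pS := map_irr_size iota p_irr.
apply: (irr_qpoly_inj p_irr) => w pw.
have cw : root (map_poly iota chi) w.
  by have /dvdpP[u ->] := p_chi; rewrite rmorphM rootM pw orbT.
rewrite horner_qpolyX // horner_in_qpoly // horner_qpoly1.
by rewrite -horner_qpolyX ?c2 ?horner_qpoly1 ?map_monic ?size_map_poly.
Qed.

(** Both characters equal the same product of values of the cocycle at Frobenius. *)
Lemma kummer_quad_char_inj (F : finFieldType) (K : closedFieldType)
    (iota : {rmorphism F -> K}) (p : {poly F})
    (c : {rmorphism K -> K} -> {poly %/ (map_poly iota p)})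
    (alpha beta : {unit {poly %/ p}}) :
  (2%:R : K) != 0 -> monic_irreducible_poly p ->
  (forall s, galois_aut iota s -> c s ^+ 2 = 1) ->
  kummer_class c alpha -> kummer_class c beta ->
  quad_char predT (val alpha) = quad_char predT (val beta).
Proof.
move=> K_odd p_irr c2 ca cb.
have [s sE] := frob_morphism iota.
have s_gal : galois_aut iota s.
  split; last by move=> x; rewrite sE -rmorphXn expf_card.
  (* Frobenius is an automorphism of K because K, being algebraically closed, contains q-th
     roots. *)
  have s_surj y : exists x, s x = y.
    have q0 : (0 < #|F|)%N := ltnW (card_finRing_gt1 F).
    have [x] := @solve_monicpoly K #|F| (fun i => if i == 0%N then y else 0) q0.
    rewrite -sE => sx; exists x; rewrite sx (bigD1 (Ordinal q0)) //= expr0 mulr1.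
    rewrite big1 ?addr0 // => i; rewrite -val_eqE /= => /negPf->.
    by rewrite mul0r.
  have [si siE] := boolp.choice s_surj.
  by exists si => // x; apply: (fmorph_inj s); rewrite siE.
have [z pz] := irr_has_root iota p_irr.
have unit0 (u : {unit {poly %/ p}}) : val u != 0.
  by rewrite -(irr_unit p_irr) (valP u).
apply: (@sign_intr_inj K K_odd); rewrite ?quad_char_sqr //.
rewrite (kummer_quad_char p_irr K_odd sE s_gal (c2 s s_gal) pz ca).
by rewrite (kummer_quad_char p_irr K_odd sE s_gal (c2 s s_gal) pz cb).
Qed.

(** As [lam] and [M] have entries in F, both g and s(g) conjugate M to lam, so g^(-1) s(g)
    centralizes M. *)
Lemma so_cocycle_exists (F : finFieldType) (K : closedFieldType)
    (iota : {rmorphism F -> K}) n (lam M : 'M[F]_n.+1) (g : 'M[K]_n.+1)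
    (r : 'I_n.+1 -> K) :
  injective r -> char_poly (map_mx iota lam) = \prod_k ('X - (r k)%:P) ->
  self_adjoint M -> char_poly M = char_poly lam -> special_orthogonal g ->
  map_mx iota lam = g *m map_mx iota M *m invmx g ->
  exists c : {rmorphism K -> K} -> {poly %/ (map_poly iota (char_poly lam))},
    is_cocycle_of M g c.
Proof.
move=> r_inj char_r M_sa charM g_so lam_conj.
suff /boolp.choice[c cP] : forall s, exists y : {poly %/ (map_poly iota (char_poly lam))},
    galois_aut iota s -> y ^+ 2 = 1 /\
      horner_mx (map_mx iota M) (y : {poly K}) = invmx g *m map_mx s g.
  by exists c.
move=> s.
(* Only the values at Galois automorphisms are constrained; elsewhere the cocycle gets the default
   value 0. *)
have [s_gal|] := boolp.pselect (galois_aut iota s); last by exists 0.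
set chi := map_poly iota (char_poly lam).
have chiE : chi = \prod_k ('X - (r k)%:P) by rewrite /chi map_char_poly.
have chi_mon : chi \is monic by rewrite map_monic char_poly_monic.
have chi_gt1 : (1 < size chi)%N by rewrite size_map_poly size_char_poly.
have [gJ g_unit] := special_orthogonal_mx g_so.
have sJ : (map_mx s g)^T *m antidiag_mx *m map_mx s g = antidiag_mx.
  by rewrite map_trmx -(map_antidiag_mx s) -!map_mxM gJ.
have s_mx (X : 'M[F]_n.+1) : map_mx s (map_mx iota X) = map_mx iota X.
  by apply/matrixP => i j; rewrite !mxE s_gal.2.
have conj_s : g *m map_mx iota M *m invmx g
    = map_mx s g *m map_mx iota M *m invmx (map_mx s g).
  by rewrite -lam_conj -(s_mx lam) lam_conj !map_mxM s_mx map_invmx.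
have charMK : char_poly (map_mx iota M) = \prod_k ('X - (r k)%:P).
  by rewrite -map_char_poly charM.
have [f [f2 fM]] :=
  cocycle_exists r_inj (map_self_adjoint iota M_sa) charMK g_unit gJ sJ conj_s.
exists (in_qpoly chi f) => _; split.
  have rootk k : root chi (r k).
    by rewrite chiE (bigD1 k) //= rootM root_XsubC eqxx.
  have chiE' : chi = \prod_(z <- [seq r k | k <- enum 'I_n.+1]) ('X - z%:P).
    by rewrite chiE big_map big_enum.
  apply: (qpoly_horner_inj _ chiE' chi_gt1); first by rewrite map_inj_uniq ?enum_uniq.
  move=> _ /mapP[k _ ->].
  by rewrite horner_qpolyX // horner_in_qpoly // horner_qpoly1 f2.
have [u ->] := in_qpoly_mod chi_mon chi_gt1 f.
have chiM : horner_mx (map_mx iota M) chi = 0.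
  by rewrite /chi -charM map_char_poly Cayley_Hamilton.
by rewrite rmorphB rmorphM /= chiM mulr0 subr0.
Qed.

Theorem proposition1p8
  (F : finFieldType) (F_odd : 2%N \notin [pchar F])
  (K : closedFieldType) (iota : {rmorphism F -> K})
  (K_alg : integralRange iota)
  (n : nat) (lam : 'M[F]_n.+1) (lam_sa : self_adjoint lam)
  (lam_sep : exists2 rs : seq K, uniq rs &
     map_poly iota (char_poly lam) = \prod_(x <- rs) ('X - x%:P))
  (m : nat) (p : 'I_m -> {poly F})
  (p_irr : forall i, monic_irreducible_poly (p i))
  (p_prod : char_poly lam = \prod_i p i)
  (eta : forall i, {unit {poly %/ p i}})
  (phi : forall i, {poly %/ p i} -> 'cV[F]_n.+1)
  (lam_eta : form_decomposition lam eta phi)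
  (delta : 'I_m -> K)
  (delta_root : forall i, root (map_poly iota (p i)) (delta i)) :
  let q := #|F| in
  let d i := (size (p i)).-1 in
  exists2 chi : 'CF(comp_group p),
    forall chi', relative_position iota lam chi' <-> chi' = chi &
    chi \is a linear_char /\
    forall i, chi (comp_gen p i) =
      ((-1) ^+ (d i).-1
       * quad_char predT ((-1) ^+ (d i)./2 : F)
       * quad_char predT (val (eta i))
       * \prod_(j | j != i) \prod_(1 <= t < (gcdn (d i) (d j)).+1)
           quad_char (degree_subfield F (K := K) (lcmn (d i) (d j)))
             (delta i - delta j ^+ (q ^ t.-1)))%:~R.
Proof.
move=> q d.
have K_odd : (2%:R : K) != 0.
  apply: contraNneq F_odd => K2; rewrite -(fmorph_pchar iota) inE /=.
  by rewrite K2 eqxx.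
have F2 : (2%:R : F) != 0.
  by apply: contraNneq K_odd => F2; rewrite -(rmorph_nat iota) F2 rmorph0.
have [rs rs_uniq rsE] := lam_sep.
have rs_size : size rs = n.+1.
  have := size_prod_XsubC rs id; rewrite -rsE size_map_poly size_char_poly.
  by case.
pose r (k : 'I_n.+1) := rs`_k.
have r_inj : injective r.
  move=> k l /eqP; rewrite nth_uniq ?rs_size ?ltn_ord // => /eqP; exact: val_inj.
have char_r : char_poly (map_mx iota lam) = \prod_k ('X - (r k)%:P).
  by rewrite -map_char_poly rsE (big_nth 0) big_mkord rs_size.
pose rep i := FinRing.unit {poly %/ p i}
  (kummer_rep_unit p_irr p_prod eta r_inj char_r i).
have unit0 i (u : {unit {poly %/ p i}}) : val u != 0.
  by rewrite -(irr_unit (p_irr i)) (valP u).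
have repE i : quad_char predT (val (rep i)) =
  (-1) ^+ (d i).-1
   * quad_char predT ((-1) ^+ (d i)./2 : F)
   * quad_char predT (val (eta i))
   * \prod_(j | j != i) \prod_(1 <= t < (gcdn (d i) (d j)).+1)
       quad_char (degree_subfield F (K := K) (lcmn (d i) (d j)))
         (delta i - delta j ^+ (q ^ t.-1)).
  apply: (quad_char_formula K_odd p_irr delta_root); rewrite ?unit0 //.
    by move=> j; apply: (coprime_roots p_prod r_inj char_r (delta_root i)).
  exact: (kummer_repE p_irr p_prod eta r_inj char_r).
have sgn2 i : (quad_char predT (val (rep i)))%:~R ^+ 2 = 1 :> algC.
  by rewrite -rmorphXn quad_char_sqr ?unit0 ?rmorph1.
have [chi chi_lin chi_gen] := comp_char_exists p_irr F2 sgn2.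
exists chi; last by split=> // i; rewrite chi_gen repE.
have c2 i (c : {rmorphism K -> K} -> {poly %/ (map_poly iota (char_poly lam))}) :
    (forall s, galois_aut iota s -> c s ^+ 2 = 1) ->
    forall s, galois_aut iota s ->
      in_qpoly (map_poly iota (p i)) (c s : {poly K}) ^+ 2 = 1.
  move=> c_sqr s s_gal; apply: (@cocycle_component_sqr _ _ _ (char_poly lam)).
  - exact: char_poly_monic.
  - by rewrite size_char_poly.
  - exact: p_irr.
  - by rewrite p_prod (bigD1 i) //= dvdp_mulr.
  exact: c_sqr.
move=> chi'; split=> [|->].
  (* For any admissible choice, [alpha i] and [rep i] are Kummer representatives of the same cocycle
     component, so they have the same quadratic character and [chi'] agrees with [chi] on the
     generators. *)
  move=> [a [g [c [alpha [a_char [g_so g_conj] g_c alphaE [lin' gen']]]]]].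
  apply: (comp_char_inj p_irr lin' chi_lin) => i; rewrite gen' chi_gen; congr (_%:~R).
  apply: (kummer_quad_char_inj K_odd (p_irr i) _ (alphaE i)).
    by apply: c2 => s /g_c[].
  exact: (cocycle_kummer_class lam_sa p_irr p_prod lam_eta r_inj char_r g_so g_conj g_c).
(* Conversely one admissible choice is built, with [rep], which depends on none of a, g and c, as
   its Kummer representatives. *)
have [a a_char] := KW_char_poly F2 (char_poly_monic lam) (size_char_poly lam).
have char_KW : char_poly (map_mx iota (KW_matrix a)) = \prod_k ('X - (r k)%:P).
  by rewrite -map_char_poly a_char map_char_poly.
have [g g_so g_conj] := special_orthogonal_conj r_inj (map_self_adjoint iota lam_sa)
  (map_self_adjoint iota (KW_self_adjoint a)) char_r char_KW.
have [c g_c] := so_cocycle_exists r_inj char_r (KW_self_adjoint a) a_char g_so g_conj.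
exists a, g, c, rep; split=> // i.
exact: (cocycle_kummer_class lam_sa p_irr p_prod lam_eta r_inj char_r g_so g_conj g_c).
Qed.
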